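(* Let $1<p<\infty$ and let $Y$ be a Banach space. Then $\mathcal{K}(\ell_p,Y)$ is an $M$-ideal in $\mathcal{L}(\ell_p,Y)$ if and only if for all $y\in Y$ and all bounded linear operators $T:\ell_p\to Y$ the condition $$\limsup_{n\to\infty}\|y+Te_n\|\le(\|y\|^p+\|T\|^p)^{1/p}$$ holds, where $(e_n)$ denotes the unit vector basis of $\ell_p$.
   Context: $\mathcal{L}(X,Y)$ is the Banach space of bounded linear operators from $X$ to $Y$ with the operator norm, $\mathcal{K}(X,Y)$ its subspace of compact operators. A closed subspace $J$ of a Banach space $E$ is an $M$-ideal in $E$ if there is a subspace $V\subset E^*$ with $E^*=J^\perp\oplus_1 V$, i.e. every $e^*\in E^*$ is uniquely $e^*=j+v$ with $j\in J^\perp$ (annihilator of $J$), $v\in V$, and $\|e^*\|=\|j\|+\|v\|$. *)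

(* Defs.v *)
From HB Require Import structures.
From mathcomp Require Import all_boot all_order all_algebra.
From mathcomp Require Import all_classical all_reals all_analysis.
From mathcomp Require Import complex.

Set Implicit Arguments.
Unset Strict Implicit.
Unset Printing Implicit Defensive.

Import Order.TTheory GRing.Theory Num.Theory.
Import numFieldNormedType.Exports.

Local Open Scope classical_set_scope.
Local Open Scope ring_scope.

(* Banach spaces are real or complex: [K] below is [R] or [R[i]]. MathComp
   norms take values in the scalar field itself, so over [R[i]] they are complex
   numbers with zero imaginary part; [rnorm] is the same norm read in [R]. *)
Variant scalars := RealScalars | ComplexScalars.

Definition scalar_field (R : realType) (s : scalars) : numFieldType :=
  match s with RealScalars => R | ComplexScalars => R[i] end.

Section RealPart.
Variables (R : realType) (s : scalars).
Local Notation K := (scalar_field R s).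

Definition of_real : R -> K :=
  match s return R -> scalar_field R s with
  | RealScalars => fun a => a
  | ComplexScalars => fun a => a%:C%C
  end.

Definition real_part : K -> R :=
  match s return scalar_field R s -> R with
  | RealScalars => fun a => a
  | ComplexScalars => fun a => complex.Re a
  end.

Lemma real_partK : cancel of_real real_part.
Proof. by rewrite /of_real /real_part; case: s. Qed.

Lemma of_real_ge0K (a : K) : 0 <= a -> of_real (real_part a) = a.
Proof.
rewrite /of_real /real_part; case: s a => //= a a0.
by apply: RRe_real; apply: ger0_real.
Qed.

Lemma of_realD a b : of_real (a + b) = of_real a + of_real b.
Proof. by rewrite /of_real; case: s => //=; rewrite rmorphD. Qed.

Lemma of_realM a b : of_real (a * b) = of_real a * of_real b.
Proof. by rewrite /of_real; case: s => //=; rewrite rmorphM. Qed.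

Lemma of_real0 : of_real 0 = 0.
Proof. by rewrite /of_real; case: s => //=; rewrite rmorph0. Qed.

Lemma of_real1 : of_real 1 = 1.
Proof. by rewrite /of_real; case: s => //=; rewrite rmorph1. Qed.

Lemma ler_of_real a b : (of_real a <= of_real b) = (a <= b).
Proof. by rewrite /of_real; case: s => //=; rewrite lecR. Qed.

Definition rnorm (V : normedZmodType K) (v : V) : R := real_part `|v|.

Section Rnorm.
Variable V : normedZmodType K.
Implicit Types u v : V.

Lemma of_real_rnorm v : of_real (rnorm v) = `|v|.
Proof. exact: of_real_ge0K. Qed.

Lemma rnorm_ge0 v : 0 <= rnorm v.
Proof. by rewrite -ler_of_real of_real0 of_real_rnorm. Qed.

Lemma rnorm0 : rnorm (0 : V) = 0.
Proof. by rewrite /rnorm normr0 -of_real0 real_partK. Qed.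

Lemma rnorm0_eq0 v : rnorm v = 0 -> v = 0.
Proof.
by move=> v0; apply/normr0_eq0; rewrite -of_real_rnorm v0 of_real0.
Qed.

Lemma ler_rnormD u v : rnorm (u + v) <= rnorm u + rnorm v.
Proof. by rewrite -ler_of_real of_realD !of_real_rnorm ler_normD. Qed.

End Rnorm.

Lemma rnormZ (V : normedModType K) (a : K) (v : V) :
  rnorm (a *: v) = rnorm (a : K^o) * rnorm v.
Proof.
by apply: (can_inj real_partK); rewrite of_realM !of_real_rnorm normrZ.
Qed.

End RealPart.
Arguments of_real {R s}.
Arguments real_part {R s}.

Section BoundedOperators.
Variables (R : realType) (s : scalars).
Local Notation K := (scalar_field R s).
Variables X Y : normedModType K.

Definition bounded_linear : {pred X -> Y} :=
  mem [set f : X -> Y | linear f /\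
    exists M : R, forall x, rnorm (f x) <= M * rnorm x].

Record bounded_op := BoundedOp {
  bop_fun :> X -> Y;
  bop_bounded_linear : bop_fun \in bounded_linear }.

HB.instance Definition _ := [isSub for bop_fun].
HB.instance Definition _ := [Choice of bounded_op by <:].

Lemma bounded_linear_submod_closed : submod_closed bounded_linear.
Proof.
split=> [|a f g]; rewrite !inE /=.
  split; first by move=> a x y; rewrite scaler0 addr0.
  by exists 0 => x; rewrite mul0r rnorm0.
move=> [lf [M fM]] [lg [N gN]]; split.
  move=> b x y; rewrite !(addrfctE, scalrfctE) /= lf lg.
  by rewrite !scalerDr addrACA !scalerA mulrC.
exists (rnorm (a : K^o) * M + N) => x; rewrite !(addrfctE, scalrfctE) /=.
rewrite (le_trans (ler_rnormD _ _)) // rnormZ mulrDl -mulrA lerD //.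
by rewrite ler_wpM2l // rnorm_ge0.
Qed.

HB.instance Definition _ :=
  GRing.isSubmodClosed.Build K (X -> Y) bounded_linear
    bounded_linear_submod_closed.
HB.instance Definition _ := [SubChoice_isSubLmodule of bounded_op by <:].

Implicit Types T : bounded_op.

Lemma bop_linear T : linear T.
Proof. by have := bop_bounded_linear T; rewrite inE => -[]. Qed.

HB.instance Definition _ T := GRing.isLinear.Build K X Y *:%R T (bop_linear T).

Lemma bop_bounded T : exists M : R, forall x, rnorm (T x) <= M * rnorm x.
Proof. by have := bop_bounded_linear T; rewrite inE => -[]. Qed.

Definition opnorm T : R := sup [set rnorm (T x) | x in [set x | rnorm x <= 1]].

Lemma opnorm_has_sup T :
  has_sup [set rnorm (T x) | x in [set x | rnorm x <= 1]].
Proof.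
split; first by exists (rnorm (T 0)), 0 => //=; rewrite rnorm0.
have [M TM] := bop_bounded T; exists `|M| => _ [x /= x1 <-].
rewrite (le_trans (TM x)) // (le_trans (ler_wpM2r (rnorm_ge0 x) (ler_norm M))) //.
by rewrite ler_piMr.
Qed.

Lemma le_opnorm T x : rnorm (T x) <= opnorm T * rnorm x.
Proof.
have [->|x0] := eqVneq x 0; first by rewrite linear0 !rnorm0 mulr0.
have nx : 0 < rnorm x.
  rewrite lt_neqAle rnorm_ge0 andbT eq_sym.
  by apply: contra_neq x0; exact: rnorm0_eq0.
have cx : rnorm (of_real (rnorm x)^-1 : K^o) = (rnorm x)^-1.
  apply: (can_inj (@real_partK R s)); rewrite of_real_rnorm ger0_norm //.
  by rewrite -of_real0 ler_of_real invr_ge0 rnorm_ge0.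
rewrite -ler_pdivrMr // mulrC -cx -rnormZ -linearZ.
apply: (ub_le_sup (opnorm_has_sup T).2).
by exists (of_real (rnorm x)^-1 *: x) => //=; rewrite rnormZ cx mulVf // gt_eqF.
Qed.

Lemma opnorm_le T (M : R) :
  (forall x, rnorm x <= 1 -> rnorm (T x) <= M) -> opnorm T <= M.
Proof.
move=> TM; apply: ge_sup; first exact: (opnorm_has_sup T).1.
by move=> _ [x /= x1 <-]; exact: TM.
Qed.

Lemma opnorm_ge0 T : 0 <= opnorm T.
Proof.
apply: (ub_le_sup (opnorm_has_sup T).2).
by exists 0; rewrite /= ?linear0 rnorm0.
Qed.

Definition bop_norm T : K := of_real (opnorm T).

Lemma bop_normD T S : bop_norm (T + S) <= bop_norm T + bop_norm S.
Proof.
rewrite /bop_norm -of_realD ler_of_real; apply: opnorm_le => x x1.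
have -> : (T + S) x = T x + S x by [].
rewrite (le_trans (ler_rnormD _ _)) // lerD // (le_trans (le_opnorm _ _)) //.
  by rewrite ler_piMr // opnorm_ge0.
by rewrite ler_piMr // opnorm_ge0.
Qed.

Lemma opnormZ_le (a : K) T : opnorm (a *: T) <= rnorm (a : K^o) * opnorm T.
Proof.
apply: opnorm_le => x x1; have -> : (a *: T) x = a *: T x by [].
rewrite rnormZ ler_wpM2l ?rnorm_ge0 // (le_trans (le_opnorm _ _)) //.
by rewrite ler_piMr // opnorm_ge0.
Qed.

Lemma bop_normZ (a : K) T : bop_norm (a *: T) = `|a| * bop_norm T.
Proof.
rewrite -(of_real_rnorm (a : K^o)) /bop_norm -of_realM; congr of_real.
apply/eqP; rewrite eq_le opnormZ_le /=.
have [->|a0] := eqVneq a 0; first by rewrite rnorm0 mul0r opnorm_ge0.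
have := opnormZ_le a^-1 (a *: T); rewrite scalerA mulVf // scale1r.
move=> /(ler_wpM2l (rnorm_ge0 (a : K^o))); rewrite mulrA => /le_trans; apply.
rewrite -(rnormZ (a : K) (a^-1 : K^o)) /GRing.scale /= mulfV //.
rewrite [X in X * _](_ : _ = 1) ?mul1r // /rnorm normr1.
by rewrite -of_real1 real_partK.
Qed.

Lemma bop_norm0_eq0 T : bop_norm T = 0 -> T = 0.
Proof.
rewrite -(@of_real0 R s) => /(can_inj (@real_partK R s)) T0.
apply/val_inj/funext => x; apply: rnorm0_eq0; apply/eqP.
by rewrite eq_le rnorm_ge0 andbT (le_trans (le_opnorm T x)) // T0 mul0r.
Qed.

HB.instance Definition _ :=
  Lmodule_isNormed.Build K bounded_op bop_normD bop_normZ bop_norm0_eq0.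

Definition compact_operators : set bounded_op :=
  [set T | precompact (T @` [set x | rnorm x <= 1])].

End BoundedOperators.
Arguments compact_operators {R s} X Y.

Section MIdeal.
Variables (R : realType) (s : scalars).
Local Notation K := (scalar_field R s).
Variable E : normedModType K.

Local Notation dual := (bounded_op E K^o).

Definition annihilator (J : set E) : set dual :=
  [set f | forall x, J x -> f x = 0].

Definition M_ideal (J : set E) : Prop :=
  [/\ closed J, submod_closed [in J] &
    exists V : set dual,
      [/\ submod_closed [in V],
          forall f : dual, exists! jv : dual * dual,
            [/\ annihilator J jv.1, V jv.2 & f = jv.1 + jv.2] &
          forall j v, annihilator J j -> V v -> `|j + v| = `|j| + `|v| ]].

End MIdeal.

Section Lp.
Variables (R : realType) (s : scalars) (p : R) (p1 : 1 <= p).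
Local Notation K := (scalar_field R s).

Definition lp_sum (x : nat -> K^o) : \bar R :=
  (\sum_(0 <= k <oo) ((rnorm (x k)) `^ p)%:E)%E.

Definition lp_summable : {pred nat -> K^o} :=
  mem [set x | (lp_sum x < +oo)%E].

(* The proof argument is a phantom: only for [1 <= p] is [lp_norm] a norm. *)
Record ell (p1 : 1 <= p) := Ell {
  ell_fun :> nat -> K^o;
  ell_summable : ell_fun \in lp_summable }.

HB.instance Definition _ := [isSub for @ell_fun p1].
HB.instance Definition _ := [Choice of ell p1 by <:].

Let p_gt0 : 0 < p. Proof. exact: lt_le_trans p1. Qed.

Lemma lp_sum_ge0 x : (0 <= lp_sum x)%E.
Proof. by apply: nneseries_ge0 => k _ _; rewrite lee_fin powR_ge0. Qed.

Lemma lp_sum_Lnorm x :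
  Lnorm counting p%:E (fun k => (rnorm (x k))%:E) = (lp_sum x `^ p^-1)%E.
Proof.
rewrite Lnorm_counting //; congr poweR; apply: eq_eseriesr => k _.
by rewrite /= ger0_norm // rnorm_ge0.
Qed.

Lemma lp_minkowski x y :
  (lp_sum (x + y)%R `^ p^-1 <= lp_sum x `^ p^-1 + lp_sum y `^ p^-1)%E.
Proof.
have pV0 : 0 <= p^-1 by rewrite invr_ge0 ltW.
rewrite -!lp_sum_Lnorm.
apply: le_trans (minkowski_EFin counting (f := fun k => rnorm (x k))
  (g := fun k => rnorm (y k)) _ _ p1) => //.
rewrite !Lnorm_counting //; apply: gt0_ler_poweR => //.
- by rewrite in_itv /= leey andbT nneseries_ge0 // => k _ _; exact: poweR_ge0.
- by rewrite in_itv /= leey andbT nneseries_ge0 // => k _ _; exact: poweR_ge0.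
apply: lee_nneseries => k _; first by move=> _; exact: poweR_ge0.
rewrite /= !ger0_norm ?addr_ge0 ?rnorm_ge0 // lee_fin.
by rewrite ge0_ler_powR ?(ltW p_gt0) ?nnegrE ?addr_ge0 ?rnorm_ge0 // ler_rnormD.
Qed.

Lemma lp_sumZ (a : K) x :
  lp_sum (a *: x) = ((rnorm (a : K^o) `^ p)%:E * lp_sum x)%E.
Proof.
rewrite /lp_sum -nneseriesZl => [|k _]; last by rewrite lee_fin powR_ge0.
by apply: eq_eseriesr => k _; rewrite scalrfctE rnormZ powRM ?rnorm_ge0.
Qed.

Lemma lp_sum0 : lp_sum 0 = 0%E.
Proof.
by apply: eseries0 => k _ _ /=; rewrite rnorm0 powR0 // gt_eqF.
Qed.

Lemma lp_sumD_lty x y :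
  (lp_sum x < +oo)%E -> (lp_sum y < +oo)%E -> (lp_sum (x + y)%R < +oo)%E.
Proof.
move=> xoo yoo; apply: (@lty_poweRy _ _ p^-1).
  by rewrite invr_neq0 // gt_eqF.
by rewrite (le_lt_trans (lp_minkowski x y)) // lte_add_pinfty // poweR_lty.
Qed.

Lemma lp_summable_submod_closed : submod_closed lp_summable.
Proof.
split=> [|a x y]; rewrite !inE /=; first by rewrite lp_sum0.
move=> xoo yoo; apply: lp_sumD_lty => //.
by rewrite lp_sumZ lte_mul_pinfty // lee_fin powR_ge0.
Qed.

HB.instance Definition _ :=
  GRing.isSubmodClosed.Build K (nat -> K^o) lp_summable
    lp_summable_submod_closed.
HB.instance Definition _ := [SubChoice_isSubLmodule of ell p1 by <:].

Implicit Types x : ell p1.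

Lemma lp_sum_fin_num x : lp_sum x \is a fin_num.
Proof.
by have := ell_summable x; rewrite inE /= ge0_fin_numE // lp_sum_ge0.
Qed.

Definition lp_norm x : R := fine (lp_sum x) `^ p^-1.

Lemma lp_normE x : (lp_norm x)%:E = (lp_sum x `^ p^-1)%E.
Proof. by rewrite -[in RHS](fineK (lp_sum_fin_num x)). Qed.

Definition ell_norm x : K := of_real (lp_norm x).

Lemma ell_normD x y : ell_norm (x + y) <= ell_norm x + ell_norm y.
Proof.
rewrite /ell_norm -of_realD ler_of_real -lee_fin.
have -> : (lp_norm (x + y))%:E =
    (lp_sum ((x : nat -> K^o) + (y : nat -> K^o))%R `^ p^-1)%E.
  exact: (lp_normE (x + y)).
have := lp_minkowski x y.
by rewrite -(lp_normE x) -(lp_normE y).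
Qed.

Lemma ell_normZ (a : K) x : ell_norm (a *: x) = `|a| * ell_norm x.
Proof.
rewrite -(of_real_rnorm (a : K^o)) /ell_norm -of_realM; congr of_real.
apply: EFin_inj.
transitivity (lp_sum (a *: (x : nat -> K^o))%R `^ p^-1)%E.
  exact: (lp_normE (a *: x)).
transitivity ((rnorm (a : K^o))%:E * (lp_norm x)%:E)%E; last exact: EFinM.
rewrite (lp_normE x) lp_sumZ.
rewrite poweRM ?lp_sum_ge0 ?lee_fin ?powR_ge0 //; congr (_ * _)%E.
by rewrite poweR_EFin -powRrM mulfV ?gt_eqF // powRr1 // rnorm_ge0.
Qed.

Lemma ell_norm0_eq0 x : ell_norm x = 0 -> x = 0.
Proof.
rewrite -(@of_real0 R s) => /(can_inj (@real_partK R s)) /eqP.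
rewrite -eqe lp_normE poweR_eq0 ?lp_sum_ge0 // => /andP[/eqP x0 _].
apply/val_inj/funext => k; apply: rnorm0_eq0; apply/eqP.
have : ((rnorm (x k) `^ p)%:E <= 0 :> \bar R)%E.
  rewrite -x0 /lp_sum (@nneseriesD1 _ _ k) //; last first.
    by move=> n _; rewrite lee_fin powR_ge0.
  by rewrite leeDl // nneseries_ge0 // => n _ _; rewrite lee_fin powR_ge0.
rewrite lee_fin => xk; have : rnorm (x k) `^ p == 0 by rewrite eq_le xk powR_ge0.
by rewrite powR_eq0 => /andP[].
Qed.

HB.instance Definition _ :=
  Lmodule_isNormed.Build K (ell p1) ell_normD ell_normZ ell_norm0_eq0.

Definition unit_seq (n : nat) : nat -> K^o := fun k => (k == n)%:R.

Lemma unit_seq_summable n : unit_seq n \in lp_summable.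
Proof.
rewrite inE /= /lp_sum (nneseries_split 0 n.+1); last first.
  by move=> k _; rewrite lee_fin powR_ge0.
rewrite [X in (_ + X)%E]eseries0 ?adde0 => [|k nk _]; last first.
  by rewrite /unit_seq gtn_eqF //= rnorm0 powR0 // gt_eqF.
by rewrite sumEFin ltry.
Qed.

Definition unit_vector (n : nat) : ell p1 := Ell p1 (unit_seq_summable n).

End Lp.

(* Main.v *)
Require Import Defs.
From mathcomp Require Import all_boot all_order all_algebra.
From mathcomp Require Import all_classical all_reals all_analysis.
From mathcomp Require Import complex ring lra.

(* Write P_n for the projection of l_p onto its first n coordinates. For p > 1
   an operator T on l_p is compact iff T P_n -> T: a failure produces a bounded
   block sequence (u_k) with T u_k close to a vector y != 0, and averaging N of
   the blocks, whose mean has norm at most N^(1/p - 1), gives a contradiction.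

   If K(l_p, Y) is an M-ideal, every functional on L x L (with the maximum norm)
   that vanishes on the diagonal of K x K splits, so Hahn-Banach gives, for
   contractions T and S with S compact, a compact k with |T + S - k| and
   |T - S - k| at most 1 + e. Take S = e_0* (x) y/a and T scaled by 1/b, evaluate
   the two operators at a e_0 + b e_n and at - a e_0 + b e_n, and average: the
   unknown vector (T - k) e_0 cancels, k e_n -> 0, and the inequality remains.

   Conversely, precomposing T with the operator that sends (e_n) to a block
   sequence turns the hypothesis into a bound on |y + T z| that is uniform in
   vectors z supported far out. By compactness of S P_m this gives
   |S P_m + T (1 - P_n)| <= 1 + e for contractions S, T and large n. The
   functionals f with f (T P_n) -> f T for all T form the complement V: the limit
   of f (T P_n) exists for every f because sum_k f (T (P_{k+1} - P_k)) converges
   absolutely, and the previous estimate makes the sum an l_1 sum. *)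

Set Implicit Arguments.
Unset Strict Implicit.
Unset Printing Implicit Defensive.

Import Order.TTheory GRing.Theory Num.Theory.
Import numFieldNormedType.Exports.

Local Open Scope classical_set_scope.
Local Open Scope ring_scope.

(** * Real and complex scalars *)

Section Scalars.
Variables (R : realType) (s : scalars).
Local Notation K := (scalar_field R s).

Lemma ltr_of_real (a b : R) : (of_real a < of_real b :> K) = (a < b).
Proof. by rewrite /of_real; case: s => //=; rewrite ltcR. Qed.

Lemma of_realN (a : R) : of_real (- a) = - of_real a :> K.
Proof. by rewrite /of_real; case: s => //=; rewrite rmorphN. Qed.

Lemma real_partD (a b : K) : real_part (a + b) = real_part a + real_part b.
Proof. by rewrite /real_part; case: s a b => //= a b; rewrite raddfD. Qed.

Lemma real_partM (t : R) (a : K) : real_part (of_real t * a) = t * real_part a.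
Proof.
rewrite /real_part /of_real; case: s a => //= -[x y].
by rewrite /= mul0r subr0.
Qed.

Lemma of_real_nat n : of_real n%:R = n%:R :> K.
Proof. by elim: n => [|n IH]; rewrite ?of_real0 // -!natr1 of_realD IH of_real1. Qed.

Lemma real_partN (a : K) : real_part (- a) = - real_part a.
Proof. by have := real_partM (-1) a; rewrite of_realN of_real1 !mulN1r. Qed.

Lemma rnorm_of_real (a : R) : rnorm (of_real a : (K : normedZmodType K)) = `|a|.
Proof.
rewrite /rnorm; case: (leP 0 a) => a0.
  by rewrite ger0_norm ?real_partK ?ger0_norm // -of_real0 ler_of_real.
rewrite -normrN -of_realN ger0_norm.
  by rewrite real_partK ltr0_norm.
by rewrite -of_real0 ler_of_real oppr_ge0 ltW.
Qed.

Lemma rnormM (a b : K) :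
  rnorm (a * b : K^o) = rnorm (a : K^o) * rnorm (b : K^o).
Proof. exact: (rnormZ (a : K) (b : K^o)). Qed.

Lemma real_part_le_rnorm (a : K) : real_part a <= rnorm (a : K^o).
Proof.
rewrite /rnorm /real_part; case: s a => /=; first by move=> a; exact: ler_norm.
move=> [x y] /=.
by rewrite (le_trans (ler_norm _)) // -sqrtr_sqr ler_wsqrtr // lerDl sqr_ge0.
Qed.

(** Rotating the argument of a functional turns a bound on real parts into a bound on moduli. *)
Lemma rotate (a : K) :
  exists2 t : K, rnorm (t : K^o) = 1 & t * a = of_real (rnorm (a : K^o)).
Proof.
have [->|a0] := eqVneq a 0.
  by exists 1; rewrite ?mul1r ?rnorm0 ?of_real0 // /rnorm normr1 -of_real1 real_partK.
exists (`|a| / a); last by rewrite divfK // of_real_rnorm.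
apply: (can_inj (@real_partK R s)); rewrite of_real_rnorm of_real1.
by rewrite normrM normfV normr_id mulfV // normr_eq0.
Qed.

Lemma of_real_gt0E (e : K) : 0 < e -> exists2 d : R, 0 < d & e = of_real d.
Proof.
move=> e0; exists (real_part e); last by rewrite of_real_ge0K // ltW.
by rewrite -ltr_of_real of_real0 of_real_ge0K // ltW.
Qed.

Section Normed.
Variable V : normedZmodType K.
Implicit Types u v : V.

Lemma rnormN v : rnorm (- v) = rnorm v.
Proof. by rewrite /rnorm normrN. Qed.

Lemma rnormB u v : rnorm (u - v) = rnorm (v - u).
Proof. by rewrite -rnormN opprB. Qed.

Lemma ler_rnormB u v : rnorm (u - v) <= rnorm u + rnorm v.
Proof. by rewrite -(rnormN v) ler_rnormD. Qed.

Lemma ler_rnorm_addl u v : rnorm u <= rnorm v + rnorm (u - v).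
Proof. by have := ler_rnormD v (u - v); rewrite addrC subrK. Qed.

Lemma rnorm_sum I (r : seq I) (P : pred I) (F : I -> V) :
  rnorm (\sum_(i <- r | P i) F i) <= \sum_(i <- r | P i) rnorm (F i).
Proof.
elim/big_ind2 : _ => [|a x b y xa yb|//]; first by rewrite rnorm0.
by rewrite (le_trans (ler_rnormD _ _)) // lerD.
Qed.

End Normed.

Lemma rnormZ_real (V : normedModType K) (t : R) (v : V) :
  rnorm (of_real t *: v) = `|t| * rnorm v.
Proof. by rewrite rnormZ rnorm_of_real. Qed.

Definition unit_net (e : R) (r : seq K) :=
  forall a : K, rnorm (a : K^o) <= 1 ->
    exists2 b, b \in r & rnorm (a - b : K^o) <= e.

End Scalars.

(** A grid of mesh 1/n < e on [-1, 1]; rounding (a + 1) n down selects the grid point for a. *)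
Lemma real_unit_net (R : realType) (e : R) : 0 < e ->
  exists r : seq R, forall a : R, `|a| <= 1 -> exists2 b, b \in r & `|a - b| <= e.
Proof.
move=> e0; set n := (Num.trunc e^-1).+1.
have n0 : 0 < n%:R :> R by rewrite ltr0n.
have ne : n%:R^-1 < e.
  rewrite -[e]invrK ltf_pV2 ?posrE ?invr_gt0 //.
  by have /truncn_itv/andP[] : 0 <= e^-1 by rewrite invr_ge0 ltW.
exists [seq j%:R / n%:R - 1 | j <- iota 0 (n * 2).+1] => a.
rewrite ler_norml => /andP[a1 a2].
have an0 : 0 <= (a + 1) * n%:R by rewrite mulr_ge0 ?(ltW n0) //; lra.
have /andP[tl tu] := truncn_itv an0; set t := Num.trunc _ in tl tu.
exists (t%:R / n%:R - 1).
  apply/mapP; exists t; rewrite // mem_iota /= add0n ltnS.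
  rewrite -(ler_nat R) (le_trans tl) // mulrC natrM.
  by rewrite ler_pM2l //; lra.
have -> : a - (t%:R / n%:R - 1) = ((a + 1) * n%:R - t%:R) / n%:R.
  by rewrite mulrBl mulfK ?gt_eqF //; lra.
rewrite ger0_norm; last by rewrite divr_ge0 ?subr_ge0 // ltW.
apply: le_trans (ltW ne); rewrite ler_piMl ?invr_ge0 ?(ltW n0) //.
by move: tu; rewrite -natr1; lra.
Qed.

Lemma unit_ball_net (R : realType) s (e : R) : 0 < e ->
  exists r, @unit_net R s e r.
Proof.
move=> e0; have e20 : 0 < e / 2 by rewrite divr_gt0.
have [r rP] := real_unit_net e20.
rewrite /unit_net /rnorm; case: s => /=.
  exists r => a /rP[b br ab]; exists b => //=.
  by rewrite (le_trans ab) // ler_pdivrMr // ler_peMr ?ltW // ltr1n.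
(* A product of two real nets of mesh e/2: the error is at most the square root of 2 (e/2)^2, which
   is below e. *)
exists [seq (a +i* b)%C | a <- r, b <- r] => -[x y] /= xy.
have sq0 (u v : R) : `|u| <= Num.sqrt (u ^+ 2 + v ^+ 2).
  by rewrite -sqrtr_sqr ler_wsqrtr // lerDl sqr_ge0.
have /rP[a ar xa] : `|x| <= 1 by exact: le_trans (sq0 x y) xy.
have /rP[b br yb] : `|y| <= 1 by rewrite (le_trans _ xy) // addrC.
exists (a +i* b)%C; first exact: allpairs_f.
have -> : ((x +i* y) - (a +i* b))%C = ((x - a) +i* (y - b))%C by [].
rewrite /= -[leRHS]ger0_norm ?(ltW e0) // -sqrtr_sqr ler_wsqrtr //.
rewrite -(real_normK (num_real (x - a))) -(real_normK (num_real (y - b))).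
have x0 := normr_ge0 (x - a); have y0 := normr_ge0 (y - b).
by nra.
Qed.

(** * The Hahn-Banach theorem *)

Section HahnBanach.
Variables (R : realType) (s : scalars).
Local Notation K := (scalar_field R s).
Variable V : lmodType K.
Implicit Types (q m : V -> R) (x y : V).

(** Homogeneity concerns real t only, so a complex space is treated as a real one here;
    [real_linear_dual] recovers complex functionals from their real parts. *)
Definition sublinear q :=
  (forall x y, q (x + y) <= q x + q y) /\
  (forall (t : R) x, 0 <= t -> q (of_real t *: x) = t * q x).

(** Serves three times: for [descend], for lower bounds of chains in Zorn's lemma, and for the
    distance to a diagonal. *)
Definition inf_fam (I : Type) (D : set I) (F : I -> V -> R) x : R :=
  inf [set F i x | i in D].

Section InfFam.
Variables (I : Type) (D : set I) (F : I -> V -> R).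
Hypothesis D0 : D !=set0.
Hypothesis Fbd : forall x, exists b, forall i, D i -> b <= F i x.

Lemma inf_fam_le i x : D i -> inf_fam D F x <= F i x.
Proof.
move=> Di; apply: ge_inf; last by exists i.
by have [b bF] := Fbd x; exists b => _ [j Dj <-]; exact: bF.
Qed.

Lemma le_inf_fam b x : (forall i, D i -> b <= F i x) -> b <= inf_fam D F x.
Proof.
move=> bF; apply: lb_le_inf; last by move=> _ [j Dj <-]; exact: bF.
by have [i Di] := D0; exists (F i x), i.
Qed.

Lemma inf_fam_sublinear :
  (forall i j x y, D i -> D j -> exists2 k, D k & F k (x + y) <= F i x + F j y) ->
  (forall i t x, D i -> 0 < t ->
     exists2 k, D k & F k (of_real t *: x) <= t * F i x) ->
  sublinear (inf_fam D F).
Proof.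
move=> Fadd Fhom.
have hom_le t x : 0 < t -> inf_fam D F (of_real t *: x) <= t * inf_fam D F x.
  move=> t0; rewrite -ler_pdivrMl //; apply: le_inf_fam => i Di.
  rewrite ler_pdivrMl //; have [k Dk kF] := Fhom i t x Di t0.
  exact: le_trans (inf_fam_le _ Dk) kF.
have hom_pos t x : 0 < t -> inf_fam D F (of_real t *: x) = t * inf_fam D F x.
  move=> t0; apply/eqP; rewrite eq_le hom_le //=.
  (* The reverse inequality is [hom_le] for t^-1 at the vector t x. *)
  have tV0 : 0 < t^-1 by rewrite invr_gt0.
  have := hom_le _ (of_real t *: x) tV0.
  rewrite scalerA -of_realM mulVf ?gt_eqF // of_real1 scale1r.
  by rewrite ler_pdivlMl.
split=> [x y|t x].
  rewrite -lerBlDr; apply: le_inf_fam => i Di.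
  rewrite lerBlDl -lerBlDr; apply: le_inf_fam => j Dj.
  rewrite lerBlDr [leRHS]addrC; have [k Dk kF] := Fadd i j x y Di Dj.
  exact: le_trans (inf_fam_le _ Dk) kF.
rewrite le_eqVlt => /predU1P[<-|]; last exact: hom_pos.
rewrite of_real0 scale0r mul0r.
(* The case t = 0: doubling the zero vector doubles the value there, so that value is 0. *)
have two_gt0 : (0 : R) < 2 by [].
by have := hom_pos 2 0 two_gt0; rewrite scaler0; lra.
Qed.

End InfFam.

Lemma sublinear0 q : sublinear q -> q 0 = 0.
Proof.
by move=> [_ qZ]; have := qZ 0 0 (lexx _); rewrite scaler0 mul0r.
Qed.

Lemma sublinear_geN q x : sublinear q -> - q (- x) <= q x.
Proof.
by move=> qs; have := qs.1 x (- x); rewrite subrr (sublinear0 qs); lra.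
Qed.

(** Lowers q to a sublinear functional with value at most - q x0 at - x0; every linear functional
    below it then agrees with q at x0. This replaces the extension from the line through x0. *)
Definition descend q x0 : V -> R :=
  inf_fam [set t : R | 0 <= t] (fun t x => q (x + of_real t *: x0) - t * q x0).

Section Descend.
Variables (q : V -> R) (qs : sublinear q) (x0 : V).

Let bounded x : exists b, forall t : R, 0 <= t ->
  b <= q (x + of_real t *: x0) - t * q x0.
Proof.
exists (- q (- x)) => t t0; rewrite -qs.2 //.
have := qs.1 (x + of_real t *: x0) (- x).
by rewrite addrAC subrr add0r; lra.
Qed.

Let inhabited : [set t : R | 0 <= t] !=set0. Proof. by exists 0 => /=. Qed.

Lemma descend_sublinear : sublinear (descend q x0).
Proof.
apply: inf_fam_sublinear => // [t u x y /= t0 u0|t u x /= t0 u0].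
  exists (t + u); first exact: addr_ge0.
  rewrite of_realD scalerDl addrACA mulrDl.
  by have := qs.1 (x + of_real t *: x0) (y + of_real u *: x0); lra.
exists (u * t); first by rewrite mulr_ge0 // ltW.
rewrite of_realM -scalerA -scalerDr qs.2; last exact: ltW.
by rewrite mulrBr mulrA.
Qed.

Lemma descend_le x : descend q x0 x <= q x.
Proof.
rewrite (le_trans (inf_fam_le bounded x (lexx 0))) //.
by rewrite of_real0 scale0r addr0 mul0r subr0.
Qed.

Lemma descendN : descend q x0 (- x0) <= - q x0.
Proof.
rewrite (le_trans (inf_fam_le bounded (- x0) ler01)) //.
by rewrite of_real1 scale1r addNr (sublinear0 qs); lra.
Qed.

End Descend.

(** Zorn's lemma for the reversed pointwise order. A nonempty chain has its pointwise infimum as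
    lower bound, finite because each member is at least - q (- x) at x. *)
Lemma minimal_sublinear q : sublinear q ->
  exists m, [/\ sublinear m, (forall x, m x <= q x) &
    forall m', sublinear m' -> (forall x, m' x <= m x) -> m' = m].
Proof.
move=> qs; pose T := {m | sublinear m /\ forall x, m x <= q x}.
pose r (a b : T) := `[< forall x, sval b x <= sval a x >].
have [|||A Atot|[m [ms mq]] min] := @Zorn T r.
- by move=> a; apply/asboolP.
- move=> a b c /asboolP ab /asboolP bc; apply/asboolP => x.
  exact: le_trans (bc x) (ab x).
- move=> [a pa] [b pb] /asboolP /= ab /asboolP /= ba; apply: eq_exist => /=.
  by apply/funext => x; apply/eqP; rewrite eq_le ab ba.
- have [->|/set0P A0] := eqVneq A set0.
    by exists (exist _ q (conj qs (fun x => lexx (q x)))).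
  have bd x : exists b, forall i, A i -> b <= sval i x.
    exists (- q (- x)) => i _; have [si iq] := svalP i.
    by rewrite (le_trans _ (sublinear_geN x si)) // lerN2.
  have inf_s : sublinear (inf_fam A (fun i : T => sval i)).
    apply: inf_fam_sublinear => // [i j x y Ai Aj|i t x Ai t0].
      have [[si _] [sj _]] := (svalP i, svalP j).
      have [/asboolP ij|/asboolP ji] := Atot i j Ai Aj.
        by exists j => //; rewrite (le_trans (sj.1 x y)) // lerD2r.
      by exists i => //; rewrite (le_trans (si.1 x y)) // lerD2l.
    by exists i => //; rewrite (svalP i).1.2 // ltW.
  have inf_q x : inf_fam A (fun i : T => sval i) x <= q x.
    have [i Ai] := A0; apply: le_trans (inf_fam_le bd x Ai) _.
    exact: (svalP i).2.
  exists (exist _ (inf_fam A (fun i : T => sval i)) (conj inf_s inf_q) : T).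
  move=> i Ai; apply/asboolP => x /=.
  exact: inf_fam_le.
exists m; split=> // m' m's m'm.
have m'q x : m' x <= q x by exact: le_trans (m'm x) (mq x).
have /min/(congr1 sval) // : r (exist _ m (conj ms mq)) (exist _ m' (conj m's m'q)).
by apply/asboolP.
Qed.

Definition real_linear m :=
  (forall x y, m (x + y) = m x + m y) /\ (forall t x, m (of_real t *: x) = t * m x).

(* Replacing m by [descend m x] cannot decrease it, so m (- x) <= - m x. *)
Lemma minimal_sublinear_linear m : sublinear m ->
  (forall m', sublinear m' -> (forall x, m' x <= m x) -> m' = m) ->
  real_linear m.
Proof.
move=> ms min.
have mN x : m (- x) = - m x.
  apply/eqP; rewrite eq_le; apply/andP; split.
    rewrite -{1}(min _ (descend_sublinear ms x) (descend_le ms x)).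
    exact: descendN.
  by have := sublinear_geN (- x) ms; rewrite opprK.
split=> [x y|t x].
  apply/eqP; rewrite eq_le ms.1 /=.
  by have := ms.1 (x + y) (- y); rewrite addrK mN; lra.
have [t0|t0] := leP 0 t; first exact: ms.2.
rewrite -[t in LHS]opprK of_realN scaleNr mN ms.2 ?oppr_ge0 ?ltW //.
by rewrite mulNr opprK.
Qed.

(** A minimal sublinear functional below [descend q x0] is linear, and m (- x0) <= - q x0 forces
    equality at x0. *)
Theorem hahn_banach q x0 : sublinear q ->
  exists m, [/\ real_linear m, (forall x, m x <= q x) & m x0 = q x0].
Proof.
move=> qs; have ds := descend_sublinear qs x0.
have [m [ms mq min]] := minimal_sublinear ds.
have [mD mZ] := minimal_sublinear_linear ms min.
have mq' x : m x <= q x by exact: le_trans (mq x) (descend_le qs x0 x).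
exists m; split=> //; apply/eqP; rewrite eq_le mq' /=.
have := le_trans (mq (- x0)) (descendN qs x0).
have -> : - x0 = of_real (-1) *: x0 by rewrite of_realN of_real1 scaleN1r.
by rewrite mZ; lra.
Qed.

End HahnBanach.

(** Over complex scalars, F is the real part of x -> F x - i F (i x). Rotating x makes f x real and
    nonnegative, so the one-sided bound on F bounds the modulus of f. *)
Lemma real_linear_dual (R : realType) (s : scalars)
    (V : normedModType (scalar_field R s)) (F : V -> R) (C : R) :
  real_linear F -> (forall x, F x <= C * rnorm x) ->
  exists f : bounded_op V (scalar_field R s)^o, forall x, real_part (f x) = F x.
Proof.
move=> [FD FZ] FC.
suff [f lf Ff] : exists2 f : V -> (scalar_field R s)^o,
    linear f & forall x, real_part (f x) = F x.
  have fb : f \in @bounded_linear R s V (scalar_field R s)^o.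
    rewrite inE; split => //; exists C => x.
    have [t t1 tfx] := rotate (f x : scalar_field R s).
    have := FC (t *: x); rewrite -Ff rnormZ t1 mul1r.
    have -> : f (t *: x) = t * f x.
      have := lf t x 0; rewrite addr0 => ->.
      have := lf 1 0 0; rewrite scaler0 addr0 scale1r -[X in X = _]addr0.
      by move=> /addrI <-; rewrite addr0.
    by rewrite tfx real_partK.
  by exists (BoundedOp fb).
case: s V F FD FZ FC => V F FD FZ _.
  by exists F => // a x y; rewrite FD FZ.
have FZ' (t : R) x : F (t%:C%C *: x) = t * F x by exact: FZ.
exists (fun x => (F x +i* (- F ('i%C *: x)))%C) => // -[a b] x y.
have ab : (a +i* b)%C = a%:C%C + b%:C%C * 'i%C :> R[i].
  by apply/eqP; rewrite eq_complex /=; apply/andP; split; apply/eqP; ring.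
have iab : 'i%C * (a +i* b)%C = a%:C%C * 'i%C + (- b)%:C%C :> R[i].
  by apply/eqP; rewrite eq_complex /=; apply/andP; split; apply/eqP; ring.
rewrite scalerDr scalerA iab ab !scalerDl !FD -!scalerA !FZ'.
apply/eqP; rewrite eq_complex /=.
rewrite !(mul0r, mulr0, mulr1, subr0, addr0, add0r).
by apply/andP; split; apply/eqP; ring.
Qed.

(** * The two-ball property of M-ideals *)

Section BopNorm.
Variables (R : realType) (s : scalars).
Local Notation K := (scalar_field R s).
Variables X Y : normedModType K.
Implicit Types T S : bounded_op X Y.

Lemma rnorm_bop T : rnorm T = opnorm T.
Proof. exact: real_partK. Qed.

Lemma rnorm_bop_le T x : rnorm x <= 1 -> rnorm (T x) <= rnorm T.
Proof.
move=> x1; rewrite rnorm_bop (le_trans (le_opnorm T x)) //.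
by rewrite ler_piMr // opnorm_ge0.
Qed.

Lemma ler_rnorm_bop T x : rnorm (T x) <= rnorm T * rnorm x.
Proof. by rewrite rnorm_bop; exact: le_opnorm. Qed.

Lemma rnorm_bop_ub T (M : R) :
  (forall x, rnorm x <= 1 -> rnorm (T x) <= M) -> rnorm T <= M.
Proof. by rewrite rnorm_bop; exact: opnorm_le. Qed.

Lemma bopD T S x : (T + S) x = T x + S x. Proof. by []. Qed.
Lemma bopB T S x : (T - S) x = T x - S x. Proof. by []. Qed.
Lemma bopZ (a : K) T x : (a *: T) x = a *: T x. Proof. by []. Qed.
Lemma bop0 x : (0 : bounded_op X Y) x = 0. Proof. by []. Qed.
Lemma bop_sum I (r : seq I) (P : pred I) (F : I -> bounded_op X Y) x :
  (\sum_(i <- r | P i) F i) x = \sum_(i <- r | P i) F i x.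
Proof. by elim/big_rec2 : _ => // i ? ? _ <-. Qed.

Lemma bopDr T x y : T (x + y) = T x + T y. Proof. exact: linearD. Qed.
Lemma bopNr T x : T (- x) = - T x. Proof. exact: linearN. Qed.
Lemma bopBr T x y : T (x - y) = T x - T y. Proof. exact: linearB. Qed.
Lemma bopZr T (a : K) x : T (a *: x) = a *: T x. Proof. exact: linearZ. Qed.
Lemma bop_sumr I (r : seq I) (P : pred I) (F : I -> X) T :
  T (\sum_(i <- r | P i) F i) = \sum_(i <- r | P i) T (F i).
Proof. exact: linear_sum. Qed.

Lemma bopP T S : (forall x, T x = S x) -> T = S.
Proof. by move=> TS; apply/val_inj/funext. Qed.

Lemma bounded_op_of (f : X -> Y) (M : R) : linear f ->
  (forall x, rnorm (f x) <= M * rnorm x) ->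
  {T : bounded_op X Y | (forall x, T x = f x)}.
Proof.
move=> lf fM; have fb : f \in @bounded_linear R s X Y.
  by rewrite inE; split => //; exists M.
by exists (BoundedOp fb).
Qed.

End BopNorm.

Section TwoBall.
Variables (R : realType) (s : scalars).
Local Notation K := (scalar_field R s).
Variable E : normedModType K.
Local Notation dual := (bounded_op E K^o).

Variable J : set E.
Hypothesis sJ : submod_closed [in J].

Let J0 : J 0. Proof. by have := sJ.1; rewrite inE. Qed.
Let JDZ a x y : J x -> J y -> J (a *: x + y).
Proof. by move=> Jx Jy; have := sJ.2 a x y; rewrite !inE; exact. Qed.
Let JZ a x : J x -> J (a *: x).
Proof. by move=> Jx; rewrite -[_ *: _]addr0; exact: JDZ. Qed.
Let JD x y : J x -> J y -> J (x + y).
Proof. by move=> Jx Jy; rewrite -[x]scale1r; exact: JDZ. Qed.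

Local Notation EE := (E * E : lmodType K)%type.

(** The distance from (A, B) to the diagonal copy of J in E x E with the maximum norm; k and - k are
    interchangeable in a subspace. *)
Definition diag_dist : EE -> R :=
  inf_fam J (fun k (AB : EE) => Num.max (rnorm (AB.1 + k)) (rnorm (AB.2 + k))).

Let bounded (AB : EE) : exists b, forall k, J k ->
  b <= Num.max (rnorm (AB.1 + k)) (rnorm (AB.2 + k)).
Proof. by exists 0 => k _; rewrite le_max rnorm_ge0. Qed.

Let nonempty : J !=set0. Proof. by exists 0. Qed.

Lemma diag_dist_sublinear : sublinear diag_dist.
Proof.
apply: inf_fam_sublinear => // [k l [A B] [C D] Jk Jl|k t [A B] Jk t0].
  exists (k + l); first exact: JD.
  rewrite /= [A + C + _]addrACA [B + D + _]addrACA ge_max; apply/andP; split;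
    by rewrite (le_trans (ler_rnormD _ _)) // lerD // le_max lexx ?orbT.
exists (of_real t *: k); first exact: JZ.
rewrite /= -!scalerDr !rnormZ_real gtr0_norm // ge_max.
by rewrite !ler_pM2l // !le_max !lexx orbT.
Qed.

(** The dual of the maximum norm is the sum norm: the suprema over A and over B are taken one after
    the other. *)
Lemma rnorm_dual_pair_le1 (f g : dual) :
  (forall A B, rnorm A <= 1 -> rnorm B <= 1 -> rnorm (f A) + rnorm (g B) <= 1) ->
  rnorm f + rnorm g <= 1.
Proof.
move=> fg; rewrite -lerBrDr; apply: rnorm_bop_ub => A A1.
rewrite lerBrDr addrC -lerBrDr; apply: rnorm_bop_ub => B B1.
by rewrite lerBrDr addrC; exact: fg.
Qed.

(** It suffices that the pair (T + S, T - S) has distance at most 1 from the diagonal. A Hahn-Banach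
    functional attaining that distance is the real part of f A + g B with |f| + |g| <= 1 and f + g
    zero on J. Splitting f and g by the M-ideal decomposition bounds its value at the pair by |f| +
    |g|. *)
Theorem M_ideal_two_ball : M_ideal J ->
  forall (T S : E) (e : R), rnorm T <= 1 -> rnorm S <= 1 -> J S -> 0 < e ->
  exists k, [/\ J k, rnorm (T + S - k) <= 1 + e & rnorm (T - S - k) <= 1 + e].
Proof.
move=> [_ _ [V [sV dec nV]]] T S e T1 S1 JS e0.
have [F [[FD FZ] Fq Fx]] := hahn_banach ((T + S, T - S) : EE) diag_dist_sublinear.
have FN AB : F (- AB) = - F AB.
  by rewrite -scaleN1r -[in LHS]of_real1 -of_realN FZ mulN1r.
have F0 : F 0 = 0 by have := FN 0; rewrite oppr0; lra.
have Fpair A B : F ((A, 0) : EE) + F ((0, B) : EE) = F ((A, B) : EE).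
  by rewrite -FD; congr F; congr pair; rewrite ?addr0 ?add0r.
have Fmax A B : F ((A, B) : EE) <= Num.max (rnorm A) (rnorm B).
  apply: le_trans (Fq _) _; apply: le_trans (inf_fam_le bounded _ J0) _.
  by rewrite /= !addr0.
have FJ k : J k -> F ((k, k) : EE) = 0.
  have FJ_le k' : J k' -> F ((k', k') : EE) <= 0.
    move=> Jk; apply: le_trans (Fq _) _.
    have JNk : J (- k') by rewrite -scaleN1r; exact: JZ.
    by apply: le_trans (inf_fam_le bounded _ JNk) _; rewrite /= !subrr rnorm0 maxxx.
  move=> Jk; apply/eqP; rewrite eq_le FJ_le //=.
  have : F ((- k, - k) : EE) <= 0.
    by apply: FJ_le; rewrite -scaleN1r; exact: JZ.
  by rewrite (_ : ((- k, - k) : EE) = - ((k, k) : EE)) // FN oppr_le0.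
have F1le A : F ((A, 0) : EE) <= 1 * rnorm A.
  by rewrite mul1r (le_trans (Fmax _ _)) // rnorm0 ge_max lexx rnorm_ge0.
have F2le A : F ((0, A) : EE) <= 1 * rnorm A.
  by rewrite mul1r (le_trans (Fmax _ _)) // rnorm0 ge_max lexx rnorm_ge0.
have F1 : real_linear (fun A : E => F ((A, 0) : EE)).
  split=> [A B|t A]; first by rewrite -FD; congr F; congr pair; rewrite addr0.
  by rewrite -FZ; congr F; congr pair; rewrite scaler0.
have F2 : real_linear (fun A : E => F ((0, A) : EE)).
  split=> [A B|t A]; first by rewrite -FD; congr F; congr pair; rewrite addr0.
  by rewrite -FZ; congr F; congr pair; rewrite scaler0.
have [f fF] := real_linear_dual F1 F1le.
have [g gF] := real_linear_dual F2 F2le.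
have fg0 : annihilator J (f + g).
  move=> k Jk; apply: rnorm0_eq0.
  have [t _ tk] := rotate ((f + g) k : K).
  rewrite -[LHS](@real_partK R s) -tk.
  have -> : t * (f + g) k = f (t *: k) + g (t *: k).
    by rewrite !linearZ -scalerDr.
  by rewrite real_partD fF gF Fpair FJ //; exact: JZ.
have fg1 : rnorm f + rnorm g <= 1.
  apply: rnorm_dual_pair_le1 => A B A1 B1.
  have [t t1 tA] := rotate (f A : K); have [u u1 uB] := rotate (g B : K).
  rewrite -[rnorm (f A)](@real_partK R s) -[rnorm (g B)](@real_partK R s) -tA -uB.
  have -> : t * f A = f (t *: A) by rewrite linearZ.
  have -> : u * g B = g (u *: B) by rewrite linearZ.
  rewrite fF gF Fpair (le_trans (Fmax _ _)) // !rnormZ t1 u1 !mul1r ge_max.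
  by rewrite A1.
have [[j1 v1] [[/= Jj1 Vv1 fE] _]] := dec f.
have [[j2 v2] [[/= Jj2 Vv2 gE] _]] := dec g.
have annD h h' : annihilator J h -> annihilator J h' -> annihilator J (h + h').
  by move=> hJ hJ' k Jk; rewrite bopD hJ // hJ' // addr0.
have V0 : V 0 by have := sV.1; rewrite inE.
have VD h h' : V h -> V h' -> V (h + h').
  by move=> Vh Vh'; have := sV.2 1 h h'; rewrite !inE scale1r; exact.
(* Since f + g annihilates J, uniqueness compares its decompositions (f + g, 0) and (j1 + j2, v1 +
   v2). *)
have v12 : v1 + v2 = 0.
  have [jv [_ uniq]] := dec (f + g).
  have E1 := uniq (f + g, 0); rewrite /= addr0 in E1.
  have E2 := uniq (j1 + j2, v1 + v2).
  have {E1} : jv = (f + g, 0) by apply: E1.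
  have {E2} -> : jv = (j1 + j2, v1 + v2).
    by apply: E2; split; [exact: annD | exact: VD | rewrite fE gE addrACA].
  by move=> /(congr1 snd).
have rnorm_split j v : annihilator J j -> V v -> rnorm (j + v) = rnorm j + rnorm v.
  by move=> Jj Vv; rewrite /rnorm nV // real_partD.
have D1 : diag_dist ((T + S, T - S) : EE) <= 1.
  rewrite -Fx -Fpair -fF -gF -real_partD.
  apply: le_trans (real_part_le_rnorm _) _.
  (* j1 and j2 vanish at S, which lies in J, and v1 T cancels v2 T. Each of the four functionals is
     left with one value at a contraction. *)
  have -> : f (T + S) + g (T - S) = j1 T + j2 T + v1 S - v2 S :> K^o.
    have := congr1 (fun h : dual => h T) v12.
    rewrite bopD bop0 => vT.
    rewrite fE gE !bopD !bopDr.
    rewrite !bopNr (Jj1 S JS) (Jj2 S JS).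
    have -> : v1 T = - v2 T by apply/eqP; rewrite -addr_eq0 vT.
    have alg (a b c d h : K) : a + 0 + (- c + d) + (b - 0 + (c - h)) = a + b + d - h.
      by ring.
    exact: alg.
  apply: le_trans fg1; rewrite fE gE !rnorm_split //.
  rewrite (le_trans (ler_rnormB _ _)) //.
  rewrite (le_trans (lerD (ler_rnormD _ _) (lexx _))) //.
  rewrite (le_trans (lerD (lerD (ler_rnormD _ _) (lexx _)) (lexx _))) //.
  have := rnorm_bop_le j1 T1; have := rnorm_bop_le j2 T1.
  by have := rnorm_bop_le v1 S1; have := rnorm_bop_le v2 S1; lra.
have : diag_dist ((T + S, T - S) : EE) < 1 + e by rewrite (le_lt_trans D1) // ltrDl.
move=> /inf_lt[].
  by exists (Num.max (rnorm (T + S + 0)) (rnorm (T - S + 0))), 0.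
move=> _ [k Jk <-] /ltW; rewrite ge_max /= => /andP[k1 k2].
by exists (- k); split; rewrite ?opprK // -scaleN1r; exact: JZ.
Qed.

End TwoBall.

(** * The norm of l_p *)

Lemma powR_mono (R : realType) (p a b : R) :
  0 <= p -> 0 <= a -> a <= b -> a `^ p <= b `^ p.
Proof. by move=> p0 a0 ab; apply: ge0_ler_powR; rewrite ?nnegrE // (le_trans a0). Qed.

Section EllNorm.
Variables (R : realType) (s : scalars) (p : R) (p1 : 1 <= p).
Local Notation K := (scalar_field R s).
Local Notation X := (ell s p1).
Local Notation e_ := (unit_vector s p1).
Implicit Types x y z : X.

Let p_gt0 : 0 < p. Proof. exact: lt_le_trans p1. Qed.
Let p_neq0 : p != 0. Proof. by rewrite gt_eqF. Qed.

Lemma powRK (a : R) : 0 <= a -> (a `^ p^-1) `^ p = a.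
Proof. by move=> a0; rewrite -powRrM mulVf // powRr1. Qed.

Lemma powRVK (a : R) : 0 <= a -> (a `^ p) `^ p^-1 = a.
Proof. by move=> a0; rewrite -powRrM mulfV // powRr1. Qed.

Lemma ler_powRp (a b : R) : 0 <= a -> 0 <= b -> (a `^ p <= b `^ p) = (a <= b).
Proof.
move=> a0 b0; apply/idP/idP => [ab|]; last first.
  by move=> ab; rewrite ge0_ler_powR ?nnegrE // ltW.
by rewrite -(powRVK a0) -(powRVK b0) ge0_ler_powR ?nnegrE ?invr_ge0 ?powR_ge0 // ltW.
Qed.

Lemma rnorm_ell_powR x : rnorm x `^ p = fine (lp_sum p x).
Proof.
rewrite /rnorm /Num.norm /= real_partK powRK //.
by apply: fine_ge0; exact: lp_sum_ge0.
Qed.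

Definition psum (f : nat -> K^o) n := \sum_(k < n) rnorm (f k) `^ p.

Lemma psum_le x n : psum x n <= rnorm x `^ p.
Proof.
rewrite rnorm_ell_powR -lee_fin fineK; last exact: lp_sum_fin_num.
rewrite /psum -(big_mkord xpredT (fun k => rnorm (x k) `^ p)) -sumEFin.
by apply: nneseries_lim_ge => k _; rewrite lee_fin powR_ge0.
Qed.

Lemma lp_sum_le (f : nat -> K^o) (M : R) :
  (forall n, psum f n <= M) -> (lp_sum p f <= M%:E)%E.
Proof.
move=> fM; apply: lime_le.
  by apply: is_cvg_nneseries => k _ _; rewrite lee_fin powR_ge0.
by apply: nearW => n; rewrite sumEFin lee_fin big_mkord; exact: fM.
Qed.

Lemma rnorm_ell_le x (c : R) : 0 <= c ->
  (forall n, psum x n <= c `^ p) -> rnorm x <= c.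
Proof.
move=> c0 xc; rewrite -ler_powRp ?rnorm_ge0 // rnorm_ell_powR.
by rewrite -lee_fin fineK ?lp_sum_le //; exact: lp_sum_fin_num.
Qed.

Lemma ell_of (f : nat -> K^o) (M : R) :
  (forall n, psum f n <= M) -> {x : X | forall k, x k = f k}.
Proof.
move=> fM; have fs : f \in @lp_summable R s p.
  by rewrite inE /= (le_lt_trans (lp_sum_le fM)) // ltry.
by exists (Ell p1 fs).
Qed.

Lemma ellP x y : (forall k, x k = y k) -> x = y.
Proof. by move=> xy; apply/val_inj/funext. Qed.

Lemma ellD x y k : (x + y) k = x k + y k. Proof. by []. Qed.
Lemma ellB x y k : (x - y) k = x k - y k. Proof. by []. Qed.
Lemma ellZ (a : K) x k : (a *: x) k = a * x k. Proof. by []. Qed.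
Lemma ell_sum I (r : seq I) (P : pred I) (F : I -> X) k :
  (\sum_(i <- r | P i) F i) k = \sum_(i <- r | P i) F i k.
Proof. by elim/big_rec2 : _ => // i ? ? _ <-. Qed.

Lemma unit_vectorE n k : e_ n k = (k == n)%:R.
Proof. by []. Qed.

Lemma rnorm_coord x k : rnorm (x k) <= rnorm x.
Proof.
rewrite -ler_powRp ?rnorm_ge0 //; apply: le_trans (psum_le x k.+1).
rewrite /psum big_ord_recr /= lerDr; apply: sumr_ge0 => i _; exact: powR_ge0.
Qed.

Definition fin_ell n (w : nat -> K) : X := \sum_(k < n) w k *: e_ k.

Lemma fin_ellE n w j : fin_ell n w j = if (j < n)%N then w j else 0.
Proof.
rewrite /fin_ell ell_sum; case: ifPn => jn.
  rewrite (bigD1 (Ordinal jn)) // ellZ unit_vectorE eqxx mulr1.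
  rewrite big1; first exact: addr0.
  move=> i ij; rewrite ellZ unit_vectorE.
  by rewrite (_ : (j == i :> nat) = false) ?mulr0 // eq_sym; apply: negbTE.
rewrite big1 // => i _; rewrite ellZ unit_vectorE.
by rewrite (_ : (j == i :> nat) = false) ?mulr0 //; apply: contraNF jn => /eqP ->.
Qed.

Lemma rnorm_dominated x y :
  (forall k, rnorm (x k) <= rnorm (y k)) -> rnorm x <= rnorm y.
Proof.
move=> xy; apply: rnorm_ell_le; first exact: rnorm_ge0.
move=> n; apply: le_trans (psum_le y n); apply: ler_sum => i _.
by rewrite ler_powRp ?rnorm_ge0.
Qed.

Lemma rnorm_fin_ell n w x :
  (forall k, (k < n)%N -> rnorm (w k : K^o) <= rnorm (x k)) ->
  rnorm (fin_ell n w) <= rnorm x.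
Proof.
move=> wx; apply: rnorm_dominated => k; rewrite fin_ellE.
by case: ifPn => [/wx//|_]; rewrite rnorm0 rnorm_ge0.
Qed.

Definition ell_head n x : X := fin_ell n x.

Lemma headE n x j : ell_head n x j = if (j < n)%N then x j else 0.
Proof. exact: fin_ellE. Qed.

Lemma rnorm_head n x : rnorm (ell_head n x) <= rnorm x.
Proof. by apply: rnorm_fin_ell => k _. Qed.

Lemma tailE n x j : (x - ell_head n x) j = if (j < n)%N then 0 else x j.
Proof. by rewrite ellB headE; case: ifP; rewrite ?subrr ?subr0. Qed.

Lemma rnorm_tail n x : rnorm (x - ell_head n x) <= rnorm x.
Proof.
apply: rnorm_dominated => k; rewrite tailE.
by case: ifPn => // _; rewrite rnorm0 rnorm_ge0.
Qed.

Lemma psumD (f : nat -> K^o) m n :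
  psum f (m + n) = psum f m + \sum_(k < n) rnorm (f (m + k)%N) `^ p.
Proof. exact: big_split_ord. Qed.

Lemma psum_mono (f : nat -> K^o) m n : (m <= n)%N -> psum f m <= psum f n.
Proof.
move=> mn; rewrite -(subnKC mn) psumD lerDl; apply: sumr_ge0 => i _; exact: powR_ge0.
Qed.

Lemma psum_ge0 (f : nat -> K^o) n : 0 <= psum f n.
Proof. by apply: sumr_ge0 => i _; exact: powR_ge0. Qed.

(** The first n + m terms of x consist of its first n terms and of the terms of the tail up to n +
    m; let m grow. *)
Lemma rnorm_split_psum n x :
  psum x n + rnorm (x - ell_head n x) `^ p <= rnorm x `^ p.
Proof.
have sx : psum x n <= rnorm x `^ p by exact: psum_le.
rewrite -lerBrDl -[leRHS]powRK ?subr_ge0 //.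
rewrite ler_powRp ?rnorm_ge0 ?powR_ge0 //.
apply: rnorm_ell_le; first exact: powR_ge0.
move=> m; rewrite powRK ?subr_ge0 // lerBrDl.
apply: le_trans (psum_le x (n + m)); rewrite psumD lerD2l.
apply: (@le_trans _ _ (psum (x - ell_head n x) (n + m))).
  exact: psum_mono (leq_addl _ _).
rewrite psumD /psum big1 ?add0r.
  by apply: ler_sum => i _; rewrite tailE ltnNge leq_addr.
by move=> i _; rewrite tailE ltn_ord rnorm0 powR0.
Qed.

Lemma rnorm_head_tail n x :
  rnorm (ell_head n x) `^ p + rnorm (x - ell_head n x) `^ p <= rnorm x `^ p.
Proof.
apply: le_trans (rnorm_split_psum n x); rewrite lerD2r.
rewrite -[leRHS]powRK ?psum_ge0 // ler_powRp ?rnorm_ge0 ?powR_ge0 //.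
apply: rnorm_ell_le; first exact: powR_ge0.
move=> m; rewrite powRK ?psum_ge0 //; case: (leqP m n) => mn.
  rewrite (le_trans _ (psum_mono _ mn)) //; apply: ler_sum => i _.
  by rewrite headE (leq_trans (ltn_ord i) mn).
rewrite -(subnKC (ltnW mn)) psumD [X in _ + X]big1 ?addr0.
  by apply: ler_sum => i _; rewrite headE ltn_ord.
by move=> i _; rewrite headE ltnNge leq_addr rnorm0 powR0.
Qed.

Lemma head_cvg x (e : R) : 0 < e ->
  exists N, forall n, (N <= n)%N -> rnorm (x - ell_head n x) <= e.
Proof.
move=> e0; have ep0 : 0 < e `^ p by exact: powR_gt0.
(* Otherwise all partial sums stay below |x|^p - e^p, and so would |x|^p itself. *)
have [N xN] : exists N, rnorm x `^ p - e `^ p <= psum x N.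
  apply: contrapT => /forallNP H.
  have H' n : psum x n <= rnorm x `^ p - e `^ p.
    by apply/ltW; rewrite ltNge; apply/negP.
  have d0 : 0 <= rnorm x `^ p - e `^ p by apply: le_trans (H' 0%N); exact: psum_ge0.
  have : rnorm x <= (rnorm x `^ p - e `^ p) `^ p^-1.
    by apply: rnorm_ell_le => [|n]; [exact: powR_ge0 | rewrite powRK].
  by rewrite -ler_powRp ?rnorm_ge0 ?powR_ge0 // powRK //; lra.
exists N => n Nn; rewrite -ler_powRp ?rnorm_ge0 ?(ltW e0) //.
rewrite -(lerD2l (psum x n)) (le_trans (rnorm_split_psum n x)) // -lerBlDr.
exact: le_trans xN (psum_mono x Nn).
Qed.

Lemma rnorm_unit_pair (a b : R) (n : nat) :
  rnorm (of_real a *: e_ 0 + of_real b *: e_ n.+1) = (`|a| `^ p + `|b| `^ p) `^ p^-1.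
Proof.
set x := _ + _.
have ab0 : 0 <= `|a| `^ p + `|b| `^ p by rewrite addr_ge0 ?powR_ge0.
have xE k : rnorm (x k) `^ p = (k == 0)%:R * `|a| `^ p + (k == n.+1)%:R * `|b| `^ p.
  rewrite /x ellD !ellZ !unit_vectorE; case: k => [|k] /=.
    by rewrite mulr1 mulr0 addr0 rnorm_of_real mul1r mul0r addr0.
  rewrite mulr0 add0r mul0r add0r; case: eqP => _.
    by rewrite mulr1 rnorm_of_real mul1r.
  by rewrite mulr0 rnorm0 powR0 // mul0r.
have sE j m : \sum_(k < m) ((k : nat) == j)%:R = (j < m)%:R :> R.
  elim: m => [|m IH]; first by rewrite big_ord0.
  rewrite big_ord_recr /= IH -natrD [in RHS]ltnS.
  by case: ltngtP.
have pE m : psum x m = (0 < m)%:R * `|a| `^ p + (n.+1 < m)%:R * `|b| `^ p.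
  rewrite /psum (eq_bigr (fun k : 'I_m =>
    (k == 0 :> nat)%:R * `|a| `^ p + (k == n.+1 :> nat)%:R * `|b| `^ p)).
    by rewrite big_split /= -!mulr_suml !sE.
  by move=> k _; rewrite xE.
apply/eqP; rewrite eq_le; apply/andP; split.
  apply: rnorm_ell_le; first exact: powR_ge0.
  move=> m; rewrite powRK // pE lerD // ler_piMl ?powR_ge0 ?lern1 ?leq_b1 //.
rewrite -ler_powRp ?rnorm_ge0 ?powR_ge0 // powRK //.
by apply: le_trans (psum_le x n.+2); rewrite pE /= ltnSn !mul1r.
Qed.

(** The growth N^(1/p), slower than N for p > 1, is what the averaging argument for compact
    operators rests on. *)
Lemma rnorm_sum_unit (r : seq nat) : uniq r ->
  rnorm (\sum_(n <- r) e_ n) <= (size r)%:R `^ p^-1.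
Proof.
move=> ur; apply: rnorm_ell_le; first exact: powR_ge0.
move=> m; rewrite powRK //.
have xE k : (\sum_(n <- r) e_ n : X) k = (k \in r)%:R.
  rewrite ell_sum; elim: r ur => [|n r IH]; first by rewrite big_nil.
  rewrite cons_uniq => /andP[nr ur]; rewrite big_cons IH // unit_vectorE inE.
  have [->|_] /= := eqVneq k n; last by rewrite add0r.
  by rewrite (negbTE nr) addr0.
rewrite /psum (eq_bigr (fun k : 'I_m => (val k \in r)%:R)); last first.
  move=> k _; rewrite xE; case: (_ \in _) => /=; last first.
    by rewrite rnorm0 powR0 // gt_eqF.
  by rewrite /rnorm normr1 -of_real1 real_partK powR1.
rewrite -natr_sum ler_nat -(big_mkord xpredT (fun k => nat_of_bool (k \in r))).
rewrite (eq_bigr (fun k => if k \in r then 1 else 0)%N); last first.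
  by move=> k _; case: (k \in r).
rewrite -big_mkcond /= sum1_count -size_filter /index_iota subn0.
apply: uniq_leq_size; first by rewrite filter_uniq // iota_uniq.
by move=> k; rewrite mem_filter => /andP[].
Qed.

Lemma rnorm_unit n : rnorm (e_ n) <= 1.
Proof. by have := @rnorm_sum_unit [:: n] isT; rewrite big_seq1 powR1. Qed.

End EllNorm.

(** * Truncations and block operators *)

Section Comp.
Variables (R : realType) (s : scalars).
Local Notation K := (scalar_field R s).

Lemma comp_bopP (X Y Z : normedModType K)
    (T : bounded_op Y Z) (S : bounded_op X Y) :
  {U : bounded_op X Z | forall x, U x = T (S x)}.
Proof.
apply: (@bounded_op_of _ _ _ _ _ (rnorm T * rnorm S)).
  by move=> a x y; rewrite bopDr bopZr bopDr bopZr.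
move=> x; rewrite (le_trans (ler_rnorm_bop _ _)) // -mulrA.
by rewrite ler_wpM2l ?rnorm_ge0 // ler_rnorm_bop.
Qed.

Definition comp_bop (X Y Z : normedModType K)
    (T : bounded_op Y Z) (S : bounded_op X Y) :=
  sval (comp_bopP T S).

Lemma comp_bopE (X Y Z : normedModType K)
    (T : bounded_op Y Z) (S : bounded_op X Y) x :
  comp_bop T S x = T (S x).
Proof. exact: svalP (comp_bopP T S) x. Qed.

Lemma rnorm_comp_bop (X Y Z : normedModType K)
    (T : bounded_op Y Z) (S : bounded_op X Y) :
  rnorm (comp_bop T S) <= rnorm T * rnorm S.
Proof.
apply: rnorm_bop_ub => x x1; rewrite comp_bopE (le_trans (ler_rnorm_bop _ _)) //.
by rewrite ler_wpM2l ?rnorm_ge0 // rnorm_bop_le.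
Qed.

End Comp.

Section Trunc.
Variables (R : realType) (s : scalars) (p : R) (p1 : 1 <= p).
Local Notation K := (scalar_field R s).
Local Notation X := (ell s p1).
Local Notation e_ := (unit_vector s p1).
Variable Y : normedModType K.
Implicit Types (T S : bounded_op X Y) (x : X) (y : Y).

Lemma rank1P k y : {T : bounded_op X Y | forall x, T x = x k *: y}.
Proof.
apply: (@bounded_op_of _ _ _ _ _ (rnorm y)).
  by move=> a x z; rewrite ellD ellZ scalerDl scalerA.
by move=> x; rewrite rnormZ mulrC ler_wpM2l ?rnorm_ge0 // rnorm_coord.
Qed.

Definition rank1 k y := sval (rank1P k y).

Lemma rank1E k y x : rank1 k y x = x k *: y.
Proof. exact: svalP (rank1P k y) x. Qed.

Lemma rnorm_rank1 k y : rnorm (rank1 k y) <= rnorm y.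
Proof.
apply: rnorm_bop_ub => x x1; rewrite rank1E rnormZ ler_piMl ?rnorm_ge0 //.
exact: le_trans (rnorm_coord _ _) x1.
Qed.

(** T composed with the diagonal multiplier w on the first n coordinates. Weights of modulus 1 will
    align the phases of a functional along the coordinates. *)
Definition wtrunc n (w : nat -> K) T := \sum_(k < n) w k *: rank1 k (T (e_ k)).

Lemma wtruncE n w T x : wtrunc n w T x = T (fin_ell p1 n (fun k => w k * x k)).
Proof.
rewrite bop_sum bop_sumr; apply: eq_bigr => k _.
by rewrite bopZ rank1E bopZr scalerA.
Qed.

Lemma rnorm_wtrunc n w T :
  (forall k, rnorm (w k : K^o) <= 1) -> rnorm (wtrunc n w T) <= rnorm T.
Proof.
move=> w1; apply: rnorm_bop_ub => x x1; rewrite wtruncE; apply: rnorm_bop_le.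
apply: le_trans x1; apply: rnorm_fin_ell => k _.
by rewrite rnormM ler_piMl // rnorm_ge0.
Qed.

(** This is T P_n, written as a sum of rank-one operators so that functionals on operators expand
    along it. *)
Definition trunc n T := \sum_(k < n) rank1 k (T (e_ k)).

Lemma truncE n T x : trunc n T x = T (ell_head n x).
Proof.
by rewrite bop_sum bop_sumr; apply: eq_bigr => k _; rewrite rank1E bopZr.
Qed.

Lemma rnorm_trunc n T : rnorm (trunc n T) <= rnorm T.
Proof.
apply: rnorm_bop_ub => x x1; rewrite truncE; apply: rnorm_bop_le.
exact: le_trans (rnorm_head _ _) x1.
Qed.

Lemma trunc_linear n (a : K) T S : trunc n (a *: T + S) = a *: trunc n T + trunc n S.
Proof. by apply: bopP => x; rewrite bopD bopZ !truncE. Qed.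

Lemma head_head m n x : (m <= n)%N -> ell_head m (ell_head n x) = ell_head m x.
Proof.
move=> mn; apply: ellP => k; rewrite !headE; case: ifP => // km.
by rewrite (leq_trans km mn).
Qed.

Lemma trunc_trunc m n T : (m <= n)%N -> trunc n (trunc m T) = trunc m T.
Proof. by move=> mn; apply: bopP => x; rewrite !truncE head_head. Qed.

End Trunc.

Section Blocks.
Variables (R : realType) (s : scalars) (p : R) (p1 : 1 <= p).
Local Notation K := (scalar_field R s).
Local Notation X := (ell s p1).
Local Notation e_ := (unit_vector s p1).

(** For strictly increasing [st] with [st 0 = 0], the b such that k lies in the block [st b, st (b +
    1)). *)
Fixpoint block_index (st : nat -> nat) k :=
  if k is k'.+1 then
    let b := block_index st k' in if st b.+1 == k then b.+1 else b
  else 0%N.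

Section BlockIndex.
Variable st : nat -> nat.
Hypothesis st0 : st 0%N = 0%N.
Hypothesis st_lt : forall n, (st n < st n.+1)%N.

Lemma block_index_itv k : (st (block_index st k) <= k < st (block_index st k).+1)%N.
Proof.
elim: k => [|k /andP[IH1 IH2]] /=; first by rewrite st0 leqnn -{1}st0 st_lt.
case: eqP => [E|/eqP E]; first by rewrite E leqnn -{1}E st_lt.
by rewrite (leq_trans IH1) // ltn_neqAle eq_sym E.
Qed.

Lemma block_start_mono m n : (m <= n)%N -> (st m <= st n)%N.
Proof.
by move=> mn; apply: (homo_leq leqnn leq_trans) => // i; exact: ltnW.
Qed.

Lemma block_indexE k n : (st n <= k < st n.+1)%N -> block_index st k = n.
Proof.
move=> /andP[nk kn]; have /andP[bk kb] := block_index_itv k.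
case: (ltngtP (block_index st k) n) => // lt; have := block_start_mono lt => h.
  by have := leq_ltn_trans (leq_trans h nk) kb; rewrite ltnn.
by have := leq_ltn_trans (leq_trans h bk) kn; rewrite ltnn.
Qed.

Lemma leq_block_start n : (n <= st n)%N.
Proof. by elim: n => // n IH; exact: leq_ltn_trans IH (st_lt n). Qed.

End BlockIndex.

(** A gliding hump: choose successive disjointly supported z_n with property Q and let J send e_n to
    z_n. Disjointness gives |J x|^p <= c^p |x|^p. *)
Lemma block_operator (Q : X -> Prop) (c : R) : 0 <= c ->
  (forall N, exists z : X, exists M,
    [/\ forall k, (k < N)%N -> z k = 0, forall k, (M <= k)%N -> z k = 0,
        rnorm z <= c & Q z]) ->
  exists J : bounded_op X X, rnorm J <= c /\ forall n, Q (J (e_ n)).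
Proof.
move=> c0 H.
have {H} [z /choice[M0 zP]] := choice H.
(* The next block starts after the support of the current one; [N.+1] keeps the starts strictly
   increasing even if that support is empty. *)
pose M N := maxn N.+1 (M0 N).
pose st n := iter n M 0%N.
have stS n : st n.+1 = M (st n) by [].
have st0 : st 0%N = 0%N by [].
have st_lt n : (st n < st n.+1)%N by rewrite stS leq_max leqnn.
pose b := block_index st.
have itvb k : (st (b k) <= k < st (b k).+1)%N by exact: block_index_itv.
have bE k n : (st n <= k < st n.+1)%N -> b k = n by exact: block_indexE.
(* All blocks laid end to end: coordinate k of J x will be w_k times the coordinate of x that
   belongs to the block of k. *)
pose w k := z (st (b k)) k.
have block_sum (x : X) n :
    psum p (fun k => w k * x (b k)) (st n) <= c `^ p * psum p x n.
  elim: n => [|n IH]; first by rewrite st0 /psum !big_ord0 mulr0.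
  rewrite -(subnKC (ltnW (st_lt n))) psumD [psum p x n.+1]big_ord_recr /=.
  rewrite mulrDr lerD //.
  have wE i : (i < st n.+1 - st n)%N ->
      rnorm (w (st n + i)%N * x (b (st n + i)%N) : K^o) `^ p =
      rnorm (z (st n) (st n + i)%N) `^ p * rnorm (x n) `^ p.
    move=> ni; have -> : b (st n + i)%N = n.
      by apply: bE; rewrite leq_addr -ltn_subRL.
    rewrite rnormM powRM ?rnorm_ge0 // /w.
    by rewrite (bE _ n) // leq_addr -ltn_subRL.
  under eq_bigr => i _ do rewrite wE //.
  rewrite -mulr_suml.
  rewrite ler_wpM2r ?powR_ge0 //.
  have [_ _ zc _] := zP (st n).
  apply: (@le_trans _ _ (rnorm (z (st n)) `^ p)).
    apply: le_trans (psum_le (z (st n)) (st n + (st n.+1 - st n))).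
    by rewrite psumD lerDr psum_ge0.
  by rewrite ler_powRp ?rnorm_ge0.
have wsum (x : X) n : psum p (fun k => w k * x (b k)) n <= (c * rnorm x) `^ p.
  apply: le_trans (psum_mono _ _ (leq_block_start st_lt n)) _.
  apply: le_trans (block_sum x n) _; rewrite powRM ?rnorm_ge0 //.
  by rewrite ler_wpM2l ?powR_ge0 // psum_le.
pose Jf x := sval (ell_of p1 (wsum x)).
have JE x k : Jf x k = w k * x (b k) by exact: svalP (ell_of p1 (wsum x)) k.
have Jbd x : rnorm (Jf x) <= c * rnorm x.
  apply: rnorm_ell_le; first by rewrite mulr_ge0 ?rnorm_ge0.
  move=> n; apply: le_trans (wsum x n); rewrite le_eqVlt; apply/orP; left.
  by apply/eqP; apply: eq_bigr => i _; rewrite JE.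
have Jlin : linear Jf.
  move=> a x y; apply: ellP => k.
  by rewrite ellD ellZ !JE ellD ellZ; ring.
have [J JJ] := bounded_op_of Jlin Jbd.
exists J; split.
  by apply: rnorm_bop_ub => x x1; rewrite JJ (le_trans (Jbd x)) // ler_piMr.
move=> n; have [zl zr _ Qz] := zP (st n).
suff -> : J (e_ n) = z (st n) by [].
apply: ellP => k; rewrite JJ JE unit_vectorE.
case: (ltnP k (st n)) => [kn|nk].
  rewrite zl //; case: eqP => [bn|]; last by rewrite mulr0.
  by have /andP[] := itvb k; rewrite bn leqNgt kn.
case: (ltnP k (st n.+1)) => [kn|nk'].
  by rewrite /w (bE k n) ?nk // eqxx mulr1.
rewrite zr; last by rewrite (leq_trans _ nk') // stS leq_maxr.
case: eqP => [bn|]; last by rewrite mulr0.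
by have /andP[_] := itvb k; rewrite bn ltnNge nk'.
Qed.

End Blocks.

(** * Compact operators on l_p *)

Section TotallyBounded.
Variables (R : realType) (s : scalars).
Local Notation K := (scalar_field R s).

Definition totally_bounded (Y : normedModType K) (A : set Y) :=
  forall e : R, 0 < e ->
    exists r : seq Y, forall x, A x -> exists2 y, y \in r & rnorm (x - y) <= e.

Lemma nbhs_rnorm (Y : normedModType K) (y : Y) (e : R) : 0 < e ->
  nbhs y [set x | rnorm (x - y) < e].
Proof.
move=> e0; have e0' : (0 : K) < of_real e by rewrite -of_real0 ltr_of_real.
apply: filterS (nbhsx_ballx y (of_real e) e0') => x.
by rewrite -ball_normE /= -of_real_rnorm ltr_of_real rnormB.
Qed.

(** An ultrafilter on the closure of A contains a ball of every radius, hence is Cauchy, and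
    converges by completeness. *)
Lemma totally_bounded_precompact (Y : completeNormedModType K) (A : set Y) :
  totally_bounded A -> precompact A.
Proof.
move=> tbA; rewrite precompactE compact_ultra => F FU FA.
have Fcauchy : cauchy F.
  apply/cauchy_exP => e /of_real_gt0E[d d0 ->].
  have [r rP] := tbA (d / 4) ltac:(by rewrite divr_gt0).
  have {}rP x : closure A x -> exists2 y, y \in r & rnorm (x - y) < d.
    have d40 : 0 < d / 4 by rewrite divr_gt0.
    move=> /(_ _ (nbhs_rnorm x d40))[z [/rP[y yr zy] /= zx]].
    exists y => //; have := ler_rnormD (x - z) (z - y).
    by rewrite addrA subrK rnormB in zx *; lra.
  have {tbA rP} : F [set x | exists2 y, y \in r & rnorm (x - y) < d].
    by apply: filterS FA => x; exact: rP.
  (* The ultrafilter contains a finite union of balls; discarding the centers one at a time finds a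
     ball that belongs to it. *)
  elim: r => [|y r IH] Fr.
    have F0 : F set0 by apply: filterS Fr => x [].
    by case: (@filter_not_empty _ F _ F0).
  have [Fy|Fy] := in_ultra_setVsetC [set x | rnorm (x - y) < d] FU.
    exists y; apply: filterS Fy => x /=.
    by rewrite -ball_normE /= -of_real_rnorm ltr_of_real rnormB.
  apply: IH; apply: filterS (filterI Fr Fy) => x /= [[z]].
  by rewrite inE => /predU1P[-> //|zr xz] _; exists z.
have Fcvg : cvg F by apply/cauchy_cvgP.
exists (lim F); split; last exact: Fcvg.
have FF : ProperFilter F by exact: ultra_proper.
have H := @closed_cvg Y Y F FF id (closure A) (@closed_closure _ A) FA (lim F).
exact: H Fcvg.
Qed.

End TotallyBounded.

Section TailNull.
Variables (R : realType) (s : scalars) (p : R) (p_gt1 : 1 < p).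
Local Notation K := (scalar_field R s).
Local Notation X := (ell s (ltW p_gt1)).
Local Notation e_ := (unit_vector s (ltW p_gt1)).

Section Normed.
Variable Y : normedModType K.
Implicit Types (T S : bounded_op X Y) (x : X) (y : Y).

Lemma bop_head_cvg T x (e : R) : 0 < e ->
  exists N, forall n, (N <= n)%N -> rnorm (T (x - ell_head n x)) <= e.
Proof.
move=> e0; have T0 : 0 < rnorm T + 1 by rewrite ltr_wpDl ?rnorm_ge0.
have [N NP] := head_cvg x (divr_gt0 e0 T0).
exists N => n /NP; rewrite ler_pdivlMr // => xn.
apply: le_trans (ler_rnorm_bop _ _) _; apply: le_trans xn.
by rewrite mulrC ler_wpM2l ?rnorm_ge0 // lerDl.
Qed.

(** Norm convergence of T P_n to T, phrased on vectors that vanish before N. It stands in for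
    compactness from here on. *)
Definition tail_null : set (bounded_op X Y) :=
  [set T | forall e : R, 0 < e -> exists N, forall x,
    rnorm x <= 1 -> (forall k, (k < N)%N -> x k = 0) -> rnorm (T x) <= e].

(** Otherwise some block operator J has |T J e_n| > e for all n. Compactness gives a cluster point y
    of T J e_n, and sums of a terms close to y grow linearly in a, while they are bounded by |T|
    a^(1/p). *)
Lemma compact_tail_null T : compact_operators X Y T -> tail_null T.
Proof.
move=> cT e e0; apply: contrapT => /forallNP H.
pose Q x := e < rnorm (T x).
have [N|J [J1 JQ]] := @block_operator _ _ _ (ltW p_gt1) Q 1 ler01.
  have /existsNP[x /not_implyP[x1 /not_implyP[xN /negP]]] := H N.
  rewrite -ltNge => ex.
  (* Cutting x to finite support may cost half of the excess of |T x| over e, so the resulting block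
     still exceeds e. *)
  have d0 : 0 < (rnorm (T x) - e) / 2 by rewrite divr_gt0 ?subr_gt0.
  have [M /(_ M (leqnn M)) TM] := bop_head_cvg T x d0.
  exists (ell_head M x), M; split.
  - by move=> k kN; rewrite headE xN // if_same.
  - by move=> k Mk; rewrite headE ltnNge Mk.
  - exact: le_trans (rnorm_head _ _) x1.
  - rewrite /Q; have := ler_rnormD (T (x - ell_head M x)) (T (ell_head M x)).
    by rewrite -bopDr subrK; lra.
pose u n := T (J (e_ n)).
case: cT => U TU [cU _].
have uF : ProperFilter (u @ \oo) by exact: fmap_proper_filter.
have [|y [_ yu]] := cU (u @ \oo) uF.
  exists 0%N => // n _; apply: TU; exists (J (e_ n)) => //=.
  apply: le_trans (ler_rnorm_bop _ _) _.
  by rewrite mulr_ile1 ?rnorm_ge0 ?rnorm_unit.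
have e40 : 0 < e / 4 by rewrite divr_gt0.
have close N : exists2 n, (N <= n)%N & rnorm (u n - y) < e / 4.
  have FN : (u @ \oo) [set u n | n in [set n | (N <= n)%N]].
    by exists N => // n /= Nn; exists n.
  have [_ [[n Nn <-] un]] := yu _ _ FN (nbhs_rnorm y e40).
  by exists n.
have many a : exists r : seq nat,
    [/\ uniq r, size r = a & forall n, n \in r -> rnorm (u n - y) < e / 4].
  elim: a => [|a [r [ur sr rP]]]; first by exists [::].
  (* An index beyond all the earlier ones keeps the list duplicate-free. *)
  have [n nM un] := close (\max_(i <- r) i).+1.
  exists (n :: r); split; rewrite /= ?sr //.
    rewrite ur andbT; apply/negP => nr; move: nM.
    by rewrite ltnNge (@leq_bigmax_seq _ r xpredT (fun i : nat => i) n nr).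
  by move=> m; rewrite inE => /predU1P[->|/rP].
have y_big : 3 / 4 * e <= rnorm y.
  have [n _ un] := close 0%N; have := JQ n; rewrite /Q -/(u n) => eu.
  by have := ler_rnorm_addl (u n) y; lra.
(* The factor e/2 is the lower bound 3e/4 for |y| minus the error e/4 of each term. *)
have bound a : a%:R * (e / 2) <= rnorm T * a%:R `^ p^-1.
  have [r [ur sr rP]] := many a.
  have uE : \sum_(n <- r) u n = T (J (\sum_(n <- r) e_ n)) by rewrite !bop_sumr.
  have h1 : rnorm (\sum_(n <- r) u n) <= rnorm T * a%:R `^ p^-1.
    rewrite uE (le_trans (ler_rnorm_bop _ _)) // ler_wpM2l ?rnorm_ge0 //.
    rewrite (le_trans (ler_rnorm_bop _ _)) // -sr.
    apply: le_trans (rnorm_sum_unit s (ltW p_gt1) ur).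
    by rewrite ler_piMl // rnorm_ge0.
  have h2 : rnorm (\sum_(n <- r) (u n - y)) <= a%:R * (e / 4).
    rewrite (le_trans (rnorm_sum _ _ _)) //.
    rewrite big_seq_cond (le_trans (ler_sum _ (_ : forall i, _ -> _ <= e / 4))) //.
      by move=> n /andP[/rP/ltW].
    by rewrite -big_seq_cond big_const_seq count_predT sr iter_addr_0 mulr_natl.
  have yE : of_real a%:R *: y = \sum_(n <- r) u n - \sum_(n <- r) (u n - y).
    rewrite -sumrB (eq_bigr (fun _ => y)); last by move=> n _; rewrite subKr.
    rewrite big_const_seq count_predT sr iter_addr_0.
    by rewrite of_real_nat scaler_nat.
  have h3 : a%:R * rnorm y <= rnorm T * a%:R `^ p^-1 + a%:R * (e / 4).
    rewrite -{1}[a%:R]ger0_norm // -rnormZ_real yE.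
    by rewrite (le_trans (ler_rnormB _ _)) // lerD.
  have h4 : a%:R * (3 / 4 * e) <= a%:R * rnorm y by rewrite ler_wpM2l.
  have -> : a%:R * (e / 2) = a%:R * (3 / 4 * e) - a%:R * (e / 4) by field.
  by rewrite lerBlDr (le_trans h4).
(* Here p > 1 enters: q is positive, so a^q exceeds 2 |T| / e for the number a chosen next, against
   [bound]. *)
pose q := 1 - p^-1.
have q0 : 0 < q by rewrite subr_gt0 invf_lt1 // (lt_trans ltr01).
pose a := (Num.trunc ((rnorm T * (2 / e)) `^ q^-1)).+1.
have a0 : 0 < a%:R :> R by rewrite ltr0n.
have C0 : 0 <= rnorm T * (2 / e) by rewrite mulr_ge0 ?rnorm_ge0 // divr_ge0 // ltW.
have Ca : (rnorm T * (2 / e)) `^ q^-1 < a%:R.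
  by have /andP[] := truncn_itv (powR_ge0 (rnorm T * (2 / e)) q^-1).
have : rnorm T * (2 / e) < a%:R `^ q.
  have := @gt0_ltr_powR R q q0 ((rnorm T * (2 / e)) `^ q^-1) a%:R.
  rewrite -powRrM mulVf ?gt_eqF // powRr1 //; apply => //.
    by rewrite nnegrE powR_ge0.
  by rewrite nnegrE ltW.
rewrite ltNge => /negP; apply.
have aE : a%:R `^ q * a%:R `^ p^-1 = a%:R :> R.
  by rewrite -powRD ?subrK ?powRr1 ?ltW // gt_eqF ?implybT.
have pa0 : 0 < (a%:R : R) `^ p^-1 by exact: powR_gt0.
rewrite -(ler_pM2r pa0) aE mulrAC -[2 / e]invf_div ler_pdivlMr ?divr_gt0 //.
Qed.

Lemma totally_bounded_span n (y : nat -> Y) (e : R) : 0 < e ->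
  exists r : seq Y, forall a : nat -> K, (forall k, rnorm (a k : K^o) <= 1) ->
    exists2 z, z \in r & rnorm (\sum_(k < n) a k *: y k - z) <= e.
Proof.
elim: n e => [|n IH] e e0.
  by exists [:: 0] => a _; exists 0; rewrite ?inE // big_ord0 subr0 rnorm0 ltW.
have e20 : 0 < e / 2 by rewrite divr_gt0.
have [r rP] := IH _ e20.
(* Adding 1 allows division also when y n = 0; the coefficients are netted with mesh (e/2) / (|y n|
   + 1). *)
have y0 : 0 < rnorm (y n) + 1 by rewrite ltr_wpDl ?rnorm_ge0.
have [t tP] := unit_ball_net s (divr_gt0 e20 y0).
exists [seq z + b *: y n | z <- r, b <- t] => a a1.
have [z zr az] := rP a a1; have [b bt ab] := tP (a n) (a1 n).
exists (z + b *: y n); first by apply/allpairsP; exists (z, b).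
rewrite big_ord_recr /= opprD addrACA -scalerBl (le_trans (ler_rnormD _ _)) //.
rewrite [leRHS](splitr e) lerD // rnormZ.
move: ab; rewrite ler_pdivlMr // => ab; apply: le_trans ab.
by rewrite ler_wpM2l ?rnorm_ge0 // lerDl.
Qed.

Lemma totally_bounded_trunc n T (e : R) : 0 < e ->
  exists r : seq Y, forall x, rnorm x <= 1 ->
    exists2 z, z \in r & rnorm (trunc n T x - z) <= e.
Proof.
move=> e0; have [r rP] := totally_bounded_span n (fun k => T (e_ k)) e0.
exists r => x x1; have [k|z zr xz] := rP x.
  exact: le_trans (rnorm_coord _ _) x1.
exists z => //; rewrite bop_sum.
by under eq_bigr do rewrite rank1E.
Qed.

Lemma tail_null_trunc n T : tail_null (trunc n T).
Proof.
move=> e e0; exists n => x _ xn; rewrite truncE (_ : ell_head n x = 0).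
  by rewrite linear0 rnorm0 ltW.
by apply: ellP => k; rewrite headE; case: ifP => // /xn.
Qed.

Lemma tail_null_cvg T (e : R) : tail_null T -> 0 < e ->
  exists N, forall n, (N <= n)%N -> rnorm (T - trunc n T) <= e.
Proof.
move=> tT e0; have [N NP] := tT e e0; exists N => n Nn.
apply: rnorm_bop_ub => x x1; rewrite bopB truncE -bopBr; apply: NP.
  exact: le_trans (rnorm_tail _ _) x1.
by move=> k kN; rewrite tailE (leq_trans kN Nn).
Qed.

Lemma tail_null_limit T :
  (forall e : R, 0 < e -> exists2 S, tail_null S & rnorm (T - S) <= e) ->
  tail_null T.
Proof.
move=> H e e0; have e20 : 0 < e / 2 by rewrite divr_gt0.
have [S tS TS] := H _ e20; have [N NP] := tS _ e20.
exists N => x x1 xN; rewrite (le_trans (ler_rnorm_addl _ (S x))) //.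
rewrite [leRHS](splitr e) lerD ?NP // -bopB.
exact: le_trans (rnorm_bop_le _ x1) TS.
Qed.

Lemma tail_null_submod : submod_closed [in tail_null].
Proof.
split=> [|a T S]; rewrite !inE.
  by move=> e e0; exists 0%N => x _ _; rewrite bop0 rnorm0 ltW.
move=> tT tS e e0; have e20 : 0 < e / 2 by rewrite divr_gt0.
have a0 : 0 < rnorm (a : K^o) + 1 by rewrite ltr_wpDl ?rnorm_ge0.
have [N NP] := tT _ (divr_gt0 e20 a0); have [M MP] := tS _ e20.
exists (maxn N M) => x x1 xNM; rewrite bopD bopZ (le_trans (ler_rnormD _ _)) //.
rewrite [leRHS](splitr e) lerD //; last first.
  by apply: MP => // k kM; apply: xNM; rewrite leq_max kM orbT.
have : rnorm (T x) <= e / 2 / (rnorm (a : K^o) + 1).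
  by apply: NP => // k kN; apply: xNM; rewrite leq_max kN.
rewrite ler_pdivlMr // rnormZ => h; apply: le_trans h.
by rewrite mulrC ler_wpM2l ?rnorm_ge0 // lerDl.
Qed.

End Normed.

Variable Y : completeNormedModType K.

(** The image of the ball under T is within e/2 of its image under T P_N, which has a finite
    e/2-net; completeness of Y does the rest. *)
Lemma tail_null_compact (T : bounded_op X Y) :
  tail_null T -> compact_operators X Y T.
Proof.
move=> tT; apply: totally_bounded_precompact => e e0.
have e20 : 0 < e / 2 by rewrite divr_gt0.
have [N NP] := tail_null_cvg tT e20.
have [r rP] := totally_bounded_trunc N T e20.
exists r => _ [x /= x1 <-]; have [z zr xz] := rP x x1; exists z => //.
have := NP N (leqnn N) => /(le_trans (rnorm_bop_le _ x1)); rewrite bopB => h.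
have := ler_rnormD (T x - trunc N T x) (trunc N T x - z); rewrite addrA subrK.
by move=> /le_trans; apply; rewrite [leRHS](splitr e) lerD.
Qed.

Lemma compact_operatorsE : compact_operators X Y = @tail_null Y.
Proof.
by apply/seteqP; split => T; [exact: compact_tail_null | exact: tail_null_compact].
Qed.

End TailNull.

(** * Necessity of the inequality *)

(** Both directions of the equivalence handle the limit superior through this epsilon form. *)
Lemma limn_esup_le (R : realType) (u : nat -> R) (l : R) :
  (limn_esup (fun n => (u n)%:E) <= l%:E)%E <->
  (forall e : R, 0 < e -> exists N, forall n, (N <= n)%N -> u n <= l + e).
Proof.
rewrite /limn_esup limf_esupE; split=> [ul e e0|H].
  have /ereal_inf_lt[_ [V [N _ VN] <-] supV] :
      (ereal_inf [set ereal_sup [set (u n)%:E | n in V] | V in \oo] < (l + e)%:E)%E.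
    by rewrite (le_lt_trans ul) // lte_fin ltrDl.
  exists N => n Nn; rewrite -lee_fin; apply: le_trans (ltW supV).
  by apply: ereal_sup_ubound; exists n => //; exact: VN.
apply/lee_addgt0Pr => e e0; have [N NP] := H e e0.
apply: ge_ereal_inf; exists (ereal_sup [set (u n)%:E | n in [set n | (N <= n)%N]]).
  by exists [set n | (N <= n)%N] => //; exists N.
by apply: ge_ereal_sup => _ [n Nn <-]; rewrite lee_fin; exact: NP.
Qed.

Section Lp2.
Variables (R : realType) (p : R) (p1 : 1 <= p).
Let p_gt0 : 0 < p. Proof. exact: lt_le_trans p1. Qed.

Definition lp2 (a b : R) := (a `^ p + b `^ p) `^ p^-1.

Lemma lp2_ge0 a b : 0 <= lp2 a b.
Proof. exact: powR_ge0. Qed.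

Lemma lp2_mono (a b c d : R) :
  0 <= a -> 0 <= b -> a <= c -> b <= d -> lp2 a b <= lp2 c d.
Proof.
move=> a0 b0 ac bd; have c0 := le_trans a0 ac; have d0 := le_trans b0 bd.
apply: ge0_ler_powR; rewrite ?nnegrE ?addr_ge0 ?powR_ge0 ?invr_ge0 ?(ltW p_gt0) //.
by rewrite lerD // ler_powRp.
Qed.

(** The triangle inequality in the span of e_0 and e_1, which realizes the plane with the p-norm,
    together with |(c, d)| <= c + d. *)
Lemma lp2_add (a b c d : R) : 0 <= a -> 0 <= b -> 0 <= c -> 0 <= d ->
  lp2 (a + c) (b + d) <= lp2 a b + (c + d).
Proof.
move=> a0 b0 c0 d0; have s : scalars by exact: RealScalars.
pose e_ := unit_vector s p1.
have lp2E (x y : R) : 0 <= x -> 0 <= y ->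
    lp2 x y = rnorm (of_real x *: e_ 0%N + of_real y *: e_ 1%N).
  by move=> x0 y0; rewrite rnorm_unit_pair !ger0_norm.
have cd : lp2 c d <= c + d.
  rewrite lp2E // (le_trans (ler_rnormD _ _)) // !rnormZ_real !ger0_norm //.
  by rewrite lerD // ler_piMr // rnorm_unit.
rewrite (lp2E (a + c) (b + d)) ?addr_ge0 // !of_realD !scalerDl addrACA.
by rewrite (le_trans (ler_rnormD _ _)) // -!lp2E // lerD2l.
Qed.

End Lp2.

Lemma half_sum_norm (R : realType) (s : scalars)
    (V : normedModType (scalar_field R s)) (u w v : V) (c : R) :
  u + w = v + v -> rnorm u <= c -> rnorm w <= c -> rnorm v <= c.
Proof.
move=> uw uc wc; have : 2 * rnorm v <= c + c.
  rewrite -[2]ger0_norm // -rnormZ_real of_real_nat scaler_nat mulr2n -uw.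
  by rewrite (le_trans (ler_rnormD _ _)) // lerD.
by rewrite mulr_natl mulr2n; lra.
Qed.

(** In the averaging of two evaluations, w and c stand for the images of a e_0, which change sign
    and cancel; t and d stand for the images of b e_n. *)
Lemma add_reflected (V : zmodType) (w t y c d : V) :
  (w + t) + y - (c + d) + ((- w + t) - (- y) - (- c + d)) =
  (y + t - d) + (y + t - d).
Proof.
have -> : (w + t) + y - (c + d) = (y + t - d) + (w - c).
  by rewrite opprD (AC (3*2)%AC ((3*2*5)*(1*4))%AC).
have -> : (- w + t) - (- y) - (- c + d) = (y + t - d) - (w - c).
  by rewrite !opprD !opprK (AC (3*2)%AC ((3*2*5)*(1*4))%AC).
by rewrite addrACA subrr addr0.
Qed.

Section Necessity.
Variables (R : realType) (s : scalars) (p : R) (p_gt1 : 1 < p).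
Local Notation K := (scalar_field R s).
Local Notation X := (ell s (ltW p_gt1)).
Local Notation e_ := (unit_vector s (ltW p_gt1)).
Variable Y : normedModType K.
Implicit Types (T S : bounded_op X Y) (y : Y).

Hypothesis two_ball : forall T S (e : R), rnorm T <= 1 -> rnorm S <= 1 ->
  compact_operators X Y S -> 0 < e ->
  exists k, [/\ compact_operators X Y k, rnorm (T + S - k) <= 1 + e &
    rnorm (T - S - k) <= 1 + e].
Hypothesis compact_rank1 : forall k y, compact_operators X Y (rank1 _ k y).

(** The two-ball property is applied to T / b and to the rank-one operator sending e_0 to y / a.
    Positive bounds a and b replace the norms, so that y = 0 and T = 0 need no separate
    treatment. *)
Lemma two_ball_unit_bound y T (a b h : R) : 0 < a -> 0 < b ->
  rnorm y <= a -> rnorm T <= b -> 0 < h ->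
  exists N, forall n, (N <= n)%N -> rnorm (y + T (e_ n)) <= (1 + h) * lp2 p a b + h.
Proof.
move=> a0 b0 ya Tb h0.
pose S := rank1 (ltW p_gt1) 0 (of_real a^-1 *: y).
pose T' := of_real b^-1 *: T.
have S1 : rnorm S <= 1.
  rewrite (le_trans (rnorm_rank1 _ _ _)) // rnormZ_real.
  rewrite ger0_norm ?invr_ge0 ?(ltW a0) //.
  by rewrite ler_pdivrMl // mulr1.
have T1 : rnorm T' <= 1.
  rewrite rnormZ_real ger0_norm ?invr_ge0 ?(ltW b0) //.
  by rewrite ler_pdivrMl // mulr1.
have [k [ck TSk TSk']] := two_ball T1 S1 (compact_rank1 _ _) h0.
have bh0 : 0 < h / b by rewrite divr_gt0.
have [N NP] := compact_tail_null ck bh0.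
(* Starting at [N.+1] excludes the index 0, so that the basis vector differs from e_0. *)
exists N.+1 => -[//|n] Nn.
have ke : rnorm (of_real b *: k (e_ n.+1)) <= h.
  rewrite rnormZ_real gtr0_norm // mulrC -ler_pdivlMr //; apply: NP.
    exact: rnorm_unit.
  move=> j jN; rewrite unit_vectorE (_ : (j == n.+1) = false) //.
  by apply/negbTE; rewrite neq_ltn (leq_trans jN) // ltnW.
have eval (c : R) : `|c| = a -> forall U : bounded_op X Y, rnorm U <= 1 + h ->
    rnorm (U (of_real c *: e_ 0%N + of_real b *: e_ n.+1)) <= (1 + h) * lp2 p a b.
  move=> ca U Uh; rewrite (le_trans (ler_rnorm_bop _ _)) //.
  rewrite rnorm_unit_pair ca gtr0_norm // ler_wpM2r ?lp2_ge0 //.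
pose z c := of_real c *: e_ 0%N + of_real b *: e_ n.+1.
have TE c : T' (z c) = of_real c *: T' (e_ 0%N) + T (e_ n.+1).
  rewrite bopDr !bopZr; congr (_ + _).
  by rewrite scalerA -of_realM mulfV ?gt_eqF // of_real1 scale1r.
have SE c : S (z c) = of_real c *: (of_real a^-1 *: y).
  by rewrite rank1E ellD !ellZ !unit_vectorE mulr1 mulr0 addr0.
have kE c : k (z c) = of_real c *: k (e_ 0%N) + of_real b *: k (e_ n.+1).
  by rewrite bopDr !bopZr.
(* The vector on the left is the mean of (T' + S - k) at a e_0 + b e_(n+1) and (T' - S - k) at - a
   e_0 + b e_(n+1). *)
have main : rnorm (y + T (e_ n.+1) - of_real b *: k (e_ n.+1)) <=
    (1 + h) * lp2 p a b.
  apply: (half_sum_norm _ (eval a (gtr0_norm a0) _ TSk) (eval (- a) _ _ TSk')).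
    rewrite !bopB !bopD !TE !SE !kE of_realN !scaleNr.
    rewrite scalerA -of_realM mulfV ?gt_eqF // of_real1 scale1r.
    exact: add_reflected.
  by rewrite normrN gtr0_norm.
have := ler_rnormD (y + T (e_ n.+1) - of_real b *: k (e_ n.+1))
  (of_real b *: k (e_ n.+1)).
by rewrite subrK => /le_trans; apply; rewrite lerD.
Qed.

End Necessity.

(** * Sufficiency of the inequality *)

Section Tends.
Variables (R : realType) (s : scalars).
Local Notation K := (scalar_field R s).

Section Normed.
Variable V : normedModType K.
Implicit Types (u w : nat -> V) (l : V).

Definition tends u l := forall e : R, 0 < e ->
  exists N, forall n, (N <= n)%N -> rnorm (u n - l) <= e.

Lemma rnorm_le_eps l (c : R) :
  (forall e : R, 0 < e -> rnorm l <= c + e) -> rnorm l <= c.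
Proof. by move=> H; apply/ler_addgt0Pr => e e0; rewrite H. Qed.

Lemma tends_uniq u l l' : tends u l -> tends u l' -> l = l'.
Proof.
move=> ul ul'; apply/eqP; rewrite -subr_eq0; apply/eqP/rnorm0_eq0/eqP.
rewrite eq_le rnorm_ge0 andbT; apply: rnorm_le_eps => e e0; rewrite add0r.
have e20 : 0 < e / 2 by rewrite divr_gt0.
have [N NP] := ul _ e20; have [M MP] := ul' _ e20.
have := NP _ (leq_maxl N M); have := MP _ (leq_maxr N M).
set n := maxn N M => h h'.
have -> : l - l' = (u n - l') - (u n - l) by rewrite opprB [RHS]addrC addrA subrK.
by rewrite (le_trans (ler_rnormB _ _)) // [leRHS](splitr e) lerD.
Qed.

Lemma tends_linear (a : K) u w l l' : tends u l -> tends w l' ->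
  tends (fun n => a *: u n + w n) (a *: l + l').
Proof.
move=> ul wl e e0; have e20 : 0 < e / 2 by rewrite divr_gt0.
have a0 : 0 < rnorm (a : K^o) + 1 by rewrite ltr_wpDl ?rnorm_ge0.
have [N NP] := ul _ (divr_gt0 e20 a0); have [M MP] := wl _ e20.
exists (maxn N M) => n; rewrite geq_max => /andP[/NP nN /MP nM].
rewrite opprD addrACA -scalerBr (le_trans (ler_rnormD _ _)) //.
rewrite [leRHS](splitr e) lerD // rnormZ.
move: nN; rewrite ler_pdivlMr // => nN; apply: le_trans nN.
by rewrite mulrC ler_wpM2l ?rnorm_ge0 // lerDl.
Qed.

Lemma tends_le u l (c : R) :
  (forall n, rnorm (u n) <= c) -> tends u l -> rnorm l <= c.
Proof.
move=> uc ul; apply: rnorm_le_eps => e /ul[N /(_ N (leqnn N)) h].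
by rewrite (le_trans (ler_rnorm_addl l (u N))) // lerD // rnormB.
Qed.

Lemma tends_const u l m : (forall n, (m <= n)%N -> u n = l) -> tends u l.
Proof.
by move=> ul e e0; exists m => n /ul ->; rewrite subrr rnorm0 ltW.
Qed.

End Normed.
End Tends.

Lemma real_series_tends (R : realType) (c : nat -> R) (M : R) :
  (forall n, \sum_(k < n) `|c k| <= M) ->
  exists l, forall e, 0 < e -> exists N, forall n, (N <= n)%N ->
    `|\sum_(k < n) c k - l| <= e.
Proof.
move=> cM.
have /normed_cvg cc : cvgn [normed series c].
  apply: nondecreasing_is_cvgn.
    by apply: nondecreasing_series => n _ _; exact: normr_ge0.
  exists M => _ [n _ <-]; apply: le_trans (cM n).
  by rewrite -(big_mkord xpredT (fun k => `|c k|)).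
exists (limn (series c)) => e e0.
have /cvgrPdist_le/(_ e e0)[N _ NP] := cc.
by exists N => n /NP /=; rewrite distrC seriesEord.
Qed.

Lemma series_tends (R : realType) (s : scalars)
    (c : nat -> (scalar_field R s)^o) (M : R) :
  (forall n, \sum_(k < n) rnorm (c k) <= M) ->
  exists l, tends (fun n => \sum_(k < n) c k) l.
Proof.
rewrite /tends; case: s c => c cM; first exact: real_series_tends cM.
have [a aP] : exists l, forall e : R, 0 < e -> exists N, forall n, (N <= n)%N ->
    `|\sum_(k < n) complex.Re (c k) - l| <= e.
  apply: (@real_series_tends R (fun k => complex.Re (c k)) M) => n.
  apply: le_trans (cM n).
  apply: ler_sum => k _; rewrite /rnorm /=; case: (c k) => x y /=.
  by rewrite -sqrtr_sqr ler_wsqrtr // lerDl sqr_ge0.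
have [b bP] : exists l, forall e : R, 0 < e -> exists N, forall n, (N <= n)%N ->
    `|\sum_(k < n) complex.Im (c k) - l| <= e.
  apply: (@real_series_tends R (fun k => complex.Im (c k)) M) => n.
  apply: le_trans (cM n).
  apply: ler_sum => k _; rewrite /rnorm /=; case: (c k) => x y /=.
  by rewrite -sqrtr_sqr ler_wsqrtr // lerDr sqr_ge0.
exists (a +i* b)%C => e e0; have e20 : 0 < e / 2 by rewrite divr_gt0.
have [N NP] := aP _ e20; have [N' NP'] := bP _ e20.
exists (maxn N N') => n; rewrite geq_max => /andP[/NP h /NP' h'].
rewrite [\sum_(k < n) c k](_ : _ =
    ((\sum_(k < n) complex.Re (c k)) +i* (\sum_(k < n) complex.Im (c k)))%C).
  move: h h'; set u := \sum_(k < n) _; set v := \sum_(k < n) _ => h h'.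
  change (Num.sqrt ((u - a) ^+ 2 + (v - b) ^+ 2) <= e).
  rewrite -[leRHS]ger0_norm ?(ltW e0) // -sqrtr_sqr ler_wsqrtr //.
  move: h h'; set x := u - a; set y := v - b => h h'.
  rewrite -(real_normK (num_real x)) -(real_normK (num_real y)).
  have x0 := normr_ge0 x; have y0 := normr_ge0 y; nra.
elim: n {h h'} => [|n IH]; first by rewrite !big_ord0.
by rewrite !big_ord_recr /= IH; case: (c n).
Qed.

Lemma seq_eventually (A : eqType) (r : seq A) (P : A -> nat -> Prop) :
  (forall i m n, (m <= n)%N -> P i m -> P i n) ->
  (forall i, i \in r -> exists N, P i N) -> exists N, forall i, i \in r -> P i N.
Proof.
move=> Pmono; elim: r => [|i r IH] H; first by exists 0%N.
have [N NP] := H i (mem_head i r).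
have [|M MP] := IH; first by move=> j jr; apply: H; rewrite inE jr orbT.
exists (maxn N M) => j; rewrite inE => /predU1P[->|/MP].
  exact: Pmono (leq_maxl N M) NP.
exact: Pmono (leq_maxr N M).
Qed.

Section Sufficiency.
Variables (R : realType) (s : scalars) (p : R) (p_gt1 : 1 < p).
Local Notation K := (scalar_field R s).
Local Notation X := (ell s (ltW p_gt1)).
Local Notation e_ := (unit_vector s (ltW p_gt1)).
Variable Y : normedModType K.
Local Notation E := (bounded_op X Y).
Implicit Types (T S : E) (y : Y) (f : bounded_op E K^o).

Section Gluing.

Hypothesis upper : forall y T, (limn_esup (fun n => (rnorm (y + T (e_ n)))%:E)
  <= (lp2 p (rnorm y) (rnorm T))%:E)%E.

(** If this fails, the offending vectors can be cut to disjoint blocks z_n. The composite T J with J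
    e_n = z_n has norm at most c, and the hypothesis for y and T J is violated along the basis. *)
Lemma tail_bound y T (c e : R) : rnorm T <= 1 -> 0 <= c -> 0 < e ->
  exists N, forall z : X, (forall k, (k < N)%N -> z k = 0) -> rnorm z <= c ->
    rnorm (y + T z) <= lp2 p (rnorm y) c + e.
Proof.
move=> T1 c0 e0; apply: contrapT => /forallNP H.
set l := lp2 p (rnorm y) c in H *.
pose Q z := l + e < rnorm (y + T z).
have [N|J [J1 JQ]] := @block_operator _ _ _ (ltW p_gt1) Q c c0.
  have /existsNP[z /not_implyP[zN /not_implyP[zc /negP]]] := H N.
  rewrite -ltNge => ez.
  have d0 : 0 < (rnorm (y + T z) - (l + e)) / 2 by rewrite divr_gt0 ?subr_gt0.
  have [M /(_ M (leqnn M)) TM] := bop_head_cvg T z d0.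
  exists (ell_head M z), M; split.
  - by move=> k kN; rewrite headE zN // if_same.
  - by move=> k Mk; rewrite headE ltnNge Mk.
  - exact: le_trans (rnorm_head _ _) zc.
  - rewrite /Q; have := ler_rnormD (T (z - ell_head M z)) (y + T (ell_head M z)).
    rewrite addrCA -bopDr subrK.
    move: (rnorm (y + T z)) (rnorm (y + T (ell_head M z))) (rnorm (T (z - _))) ez TM.
    by move=> r1 r2 r3; lra.
have /limn_esup_le := upper y (comp_bop T J).
have e20 : 0 < e / 2 by rewrite divr_gt0.
move=> /(_ _ e20)[N /(_ N (leqnn N))]; rewrite comp_bopE.
have Tc : rnorm (comp_bop T J) <= c.
  rewrite (le_trans (rnorm_comp_bop _ _)) // (le_trans _ J1) //.
  by rewrite ler_piMl // rnorm_ge0.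
have h := lp2_mono (ltW p_gt1) (rnorm_ge0 y) (rnorm_ge0 (comp_bop T J)) (lexx _) Tc.
move=> h'; have := JQ N; rewrite /Q ltNge => /negP; apply.
by apply: le_trans h' _; rewrite lerD // ler_pdivrMr // ler_peMr ?ler1n // ltW.
Qed.

(** At x the operator is S (P_m x) + T z with z = x - P_n x, where |P_m x|^p + |z|^p <= 1. Finite
    nets for S P_m x and for |z| reduce the estimate to finitely many uses of [tail_bound]. *)
Lemma gluing T S m (e : R) : rnorm T <= 1 -> rnorm S <= 1 -> 0 < e ->
  exists N, forall n, (N <= n)%N -> rnorm (trunc m S + (T - trunc n T)) <= 1 + e.
Proof.
move=> T1 S1 e0; pose d := e / 8.
have d0 : 0 < d by rewrite divr_gt0.
have [ry ryP] := totally_bounded_trunc m S d0.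
have [rc rcP] := real_unit_net d0.
(* The absolute value makes the radius nonnegative for every b in the net; for the b close to |z| it
   is just b + d. *)
pose P (yb : Y * R) N := forall z : X, (forall k, (k < N)%N -> z k = 0) ->
  rnorm z <= `|yb.2 + d| -> rnorm (yb.1 + T z) <= lp2 p (rnorm yb.1) `|yb.2 + d| + d.
have [yb i j ij Pi z zj|yb _|N NP] := @seq_eventually _ (allpairs pair ry rc) P.
- by apply: Pi => k ki; apply: zj; exact: leq_trans ki ij.
- exact: tail_bound.
(* With n >= m the supports of P_m x and x - P_n x are disjoint. *)
exists (maxn N m) => n; rewrite geq_max => /andP[Nn mn].
apply: rnorm_bop_ub => x x1; rewrite bopD bopB [trunc n T x]truncE -bopBr.
set z := x - ell_head n x.
set a := rnorm (ell_head m x); set c := rnorm z.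
have ac1 : lp2 p a c <= 1.
  have p0 : 0 <= p by rewrite (le_trans ler01) // ltW.
  have hx : rnorm (ell_head m x) `^ p <= rnorm (ell_head n x) `^ p.
    apply: powR_mono p0 (rnorm_ge0 _) _.
    by rewrite -(head_head x mn); exact: rnorm_head.
  have x1p : rnorm x `^ p <= 1.
    by have := powR_mono p0 (rnorm_ge0 x) x1; rewrite powR1.
  have ac : rnorm (ell_head m x) `^ p + rnorm z `^ p <= 1.
    apply: le_trans (lerD hx (lexx _)) _.
    exact: le_trans (rnorm_head_tail n x) x1p.
  have pV0 : 0 <= p^-1 by rewrite invr_ge0.
  have := powR_mono pV0 (addr_ge0 (powR_ge0 _ _) (powR_ge0 _ _)) ac.
  by rewrite powR1.
have c1 : `|c| <= 1.
  by rewrite (ger0_norm (rnorm_ge0 z)); exact: le_trans (rnorm_tail n x) x1.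
have [y yr Sy] := ryP x x1; have [b br cb] := rcP c c1.
have /NP/(_ z) : (y, b) \in allpairs pair ry rc by apply/allpairsP; exists (y, b).
rewrite /P /=.
move: cb; rewrite ler_norml => /andP[cb1 cb2].
have c0 : 0 <= c by exact: rnorm_ge0.
have bd0 : 0 <= b + d by lra.
rewrite (ger0_norm bd0) -/c => Tz.
have {}Tz : rnorm (y + T z) <= lp2 p (rnorm y) (b + d) + d.
  apply: Tz; last by lra.
  by move=> k kN; have := tailE n x k; rewrite (leq_trans kN Nn); exact.
have a0 : 0 <= a by exact: rnorm_ge0.
have ya : rnorm y <= a + d.
  have Sa : rnorm (trunc m S x) <= a.
    rewrite truncE; apply: le_trans (ler_rnorm_bop _ _) _.
    by rewrite -[leRHS]mul1r; exact: ler_wpM2r a0 _ _ S1.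
  apply: le_trans (ler_rnorm_addl y (trunc m S x)) _.
  by apply: lerD Sa _; rewrite rnormB.
have l1 : lp2 p (rnorm y) (b + d) <= lp2 p (a + d) (c + (d + d)).
  have bc : b + d <= c + (d + d) by clear -cb1; lra.
  apply: lp2_mono ya bc; [exact: ltW | exact: rnorm_ge0 | exact: bd0].
have l2 : lp2 p (a + d) (c + (d + d)) <= lp2 p a c + (d + (d + d)).
  by apply: lp2_add => //; [exact: ltW | exact: ltW | rewrite addr_ge0 // ltW].
have := ler_rnormD (trunc m S x - y) (y + T z); rewrite addrA subrK => h.
apply: le_trans h _.
move: (rnorm (trunc m S x - y)) (rnorm (y + T z)) Sy Tz l1 l2 ac1.
move: (lp2 _ _ _) (lp2 _ _ _) (lp2 _ _ _) => u1 u2 u3 u4 u5.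
by rewrite /d in d0 *; lra.
Qed.

End Gluing.

End Sufficiency.

(** * The decomposition of the dual and its l_1 norm *)

Section MIdealCompact.
Variables (R : realType) (s : scalars) (p : R) (p_gt1 : 1 < p).
Local Notation K := (scalar_field R s).
Local Notation X := (ell s (ltW p_gt1)).
Local Notation e_ := (unit_vector s (ltW p_gt1)).
Variable Y : normedModType K.
Local Notation E := (bounded_op X Y).
Local Notation dual := (bounded_op E K^o).
Implicit Types (T S : E) (y : Y) (f j v : dual).

Lemma closed_tail_null : closed (@tail_null _ _ _ p_gt1 Y).
Proof.
move=> T clT; apply: tail_null_limit => e e0.
have [S [tS /= TS]] := clT _ (nbhs_rnorm T e0).
by exists S => //; rewrite rnormB; exact: ltW.
Qed.

Definition trunc_continuous : set dual :=
  [set f | forall T, tends (fun n => f (trunc n T)) (f T)].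

Lemma trunc_continuous_submod : submod_closed [in trunc_continuous].
Proof.
split=> [|a f g]; rewrite !inE.
  by move=> T; apply: (@tends_const _ _ _ _ _ 0%N) => n _; rewrite !bop0.
by move=> fV gV T; exact: tends_linear (fV T) (gV T).
Qed.

(** Choose w_k of modulus 1 making each term of f ([wtrunc n w T]) equal to its modulus; the
    weighted truncation still has norm at most |T|. *)
Lemma dual_trunc_sum f T n :
  \sum_(k < n) rnorm (f (rank1 (ltW p_gt1) k (T (e_ k)))) <= rnorm f * rnorm T.
Proof.
have [w wP] := choice (fun k => let: ex_intro2 t t1 tk :=
  rotate (f (rank1 (ltW p_gt1) k (T (e_ k))) : K) in ex_intro _ t (conj t1 tk)).
have fw : f (wtrunc n w T) =
    of_real (\sum_(k < n) rnorm (f (rank1 (ltW p_gt1) k (T (e_ k))))).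
  rewrite bop_sumr; elim: n => [|n IH]; first by rewrite !big_ord0 of_real0.
  by rewrite !big_ord_recr /= IH of_realD bopZr -(wP n).2.
have w1 k : rnorm (w k : K^o) <= 1 by rewrite (wP k).1.
apply: le_trans (ler_norm _) _; rewrite -(rnorm_of_real s) -fw.
apply: le_trans (ler_rnorm_bop _ _) _.
exact: ler_wpM2l (rnorm_ge0 f) _ _ (rnorm_wtrunc n T w1).
Qed.

(** The increments of f (T P_n) are absolutely summable by [dual_trunc_sum]; the limit is linear in
    T and bounded by |f| |T|. This v is the component of f in [trunc_continuous]. *)
Lemma trunc_part f : exists v : dual,
  forall T, tends (fun n => f (trunc n T)) (v T).
Proof.
have lim T : exists l : K^o, tends (fun n => f (trunc n T)) l.
  have [l lP] := @series_tends R s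
    (fun k => f (rank1 (ltW p_gt1) k (T (e_ k)))) _ (dual_trunc_sum f T).
  exists l => e /lP[N NP].
  by exists N => n /NP; rewrite bop_sumr.
have [v vP] := choice lim.
have vlin : linear v.
  move=> a T S; apply: tends_uniq (vP _) _.
  have := tends_linear a (vP T) (vP S); congr tends.
  by apply/funext => n; rewrite trunc_linear bopDr bopZr.
have vb T : rnorm (v T) <= rnorm f * rnorm T.
  apply: tends_le (vP T) => n; apply: le_trans (ler_rnorm_bop _ _) _.
  exact: ler_wpM2l (rnorm_ge0 f) _ _ (rnorm_trunc n T).
have [v' v'E] := bounded_op_of vlin vb.
by exists v' => T; rewrite v'E.
Qed.

Lemma tends_tail_null f T : tail_null T -> tends (fun n => f (trunc n T)) (f T).
Proof.
move=> tT e e0; have f0 : 0 < rnorm f + 1 by rewrite ltr_wpDl ?rnorm_ge0.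
have [N NP] := tail_null_cvg tT (divr_gt0 e0 f0).
exists N => n /NP; rewrite ler_pdivlMr // => Tn; rewrite rnormB -bopBr.
apply: le_trans (ler_rnorm_bop _ _) _; apply: le_trans Tn.
by rewrite mulrC ler_wpM2l ?rnorm_ge0 // lerDl.
Qed.

Lemma norming_vector f (e : R) : 0 < e ->
  exists T, rnorm T <= 1 /\ exists2 t : R, f T = of_real t & rnorm f - e <= t.
Proof.
move=> e0; apply: contrapT => /forallNP H.
suff : rnorm f <= rnorm f - e by rewrite lerBrDl gerDr leNgt e0.
apply: rnorm_bop_ub => T T1; apply: contrapT => /negP; rewrite -ltNge => fT.
have [a a1 aT] := rotate (f T : K).
apply: (H (a *: T)); split; first by rewrite rnormZ a1 mul1r.
by exists (rnorm (f T)); rewrite ?bopZr // ltW.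
Qed.

Hypothesis upper : forall y T, (limn_esup (fun n => (rnorm (y + T (e_ n)))%:E)
  <= (lp2 p (rnorm y) (rnorm T))%:E)%E.

(** Test j + v on W = S P_m + T - T P_n, where T almost norms j and S almost norms v. Then j W = j
    T, v W is close to v S for large m and n, and [gluing] gives |W| <= 1 + d. *)
Lemma rnorm_annihilator_trunc j v :
  annihilator (@tail_null _ _ _ p_gt1 Y) j -> trunc_continuous v ->
  rnorm (j + v) = rnorm j + rnorm v.
Proof.
move=> jJ vV; apply/eqP; rewrite eq_le ler_rnormD /=.
set M := rnorm (j + v).
(* Two of the four d come from the almost norming operators, two from replacing v (S P_m) by v S and
   v (T P_n) by v T. *)
suff H (d : R) : 0 < d -> rnorm j + rnorm v <= M * (1 + d) + 4 * d.
  apply/ler_addgt0Pr => e e0.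
  have M0 : 0 <= M by exact: rnorm_ge0.
  have M4 : 0 < M + 4 by rewrite ltr_wpDl.
  have /H h : 0 < e / (M + 4) by rewrite divr_gt0.
  apply: le_trans h _; rewrite le_eqVlt; apply/orP; left; apply/eqP.
  by field; rewrite gt_eqF.
move=> d0.
have [T [T1 [tj jT jt]]] := norming_vector j d0.
have [S [S1 [tv vS vt]]] := norming_vector v d0.
have [m /(_ m (leqnn m)) vm] := vV S d d0.
have [N1 N1P] := gluing upper m T1 S1 d0.
have [N2 N2P] := vV T d d0.
pose n := maxn N1 N2.
have W1 := N1P n (leq_maxl _ _).
have vn := N2P n (leq_maxr _ _).
set W := trunc m S + (T - trunc n T) in W1.
have WE : (j + v) W = of_real tj +
    (of_real tv + (v (trunc m S) - v S) - (v (trunc n T) - v T)).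
  rewrite bopD !bopDr !bopNr (jJ _ (@tail_null_trunc _ _ _ p_gt1 _ m S)).
  rewrite (jJ _ (@tail_null_trunc _ _ _ p_gt1 _ n T)) jT -vS.
  rewrite oppr0 add0r addr0; congr (_ + _).
  by rewrite opprB [v S + _]addrC subrK.
have lower : tj + (tv - d - d) <= rnorm ((j + v) W).
  have real_part_geN (a : K) : - rnorm (a : K^o) <= real_part a.
    rewrite -rnormN -[leRHS]opprK lerN2 -real_partN; exact: real_part_le_rnorm.
  apply: le_trans (real_part_le_rnorm _); rewrite WE.
  move: (v (trunc m S) - v S) (v (trunc n T) - v T) vm vn => A B Ad Bd.
  rewrite !real_partD !real_partK lerD2l real_partN; apply: lerD.
    by rewrite lerD2l; apply: le_trans (real_part_geN _); rewrite lerN2.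
  by rewrite lerN2; apply: le_trans Bd; exact: real_part_le_rnorm.
have up : rnorm ((j + v) W) <= M * (1 + d).
  apply: le_trans (ler_rnorm_bop _ _) _.
  exact: ler_wpM2l (rnorm_ge0 _) _ _ W1.
apply: (@le_trans _ _ (rnorm ((j + v) W) + 4 * d)); last by rewrite lerD2r.
move: (rnorm ((j + v) W)) (rnorm j) (rnorm v) lower jt vt => r1 r2 r3; lra.
Qed.

(** With v the limit of f along truncations, f - v vanishes on tail-null operators because T P_n ->
    T in norm there. In any decomposition f = j' + v', j' kills every T P_n, so v' is the same
    limit. *)
Lemma M_ideal_tail_null : M_ideal (@tail_null _ _ _ p_gt1 Y).
Proof.
split; [exact: closed_tail_null | exact: tail_null_submod | ].
exists trunc_continuous; split; first exact: trunc_continuous_submod.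
- move=> f; have [v vP] := trunc_part f.
  (* The sequence defining v at T P_m is constant from index m on; hence v itself lies in
     [trunc_continuous]. *)
  have v_fin m T : v (trunc m T) = f (trunc m T).
    apply: tends_uniq (vP _) _; apply: (@tends_const _ _ _ _ _ m) => n mn.
    by rewrite trunc_trunc.
  exists (f - v, v); split=> /= [|[j' v'] /= [j'J v'V fE]].
    split; last by rewrite subrK.
      by move=> T tT; rewrite bopB (tends_uniq (vP T) (tends_tail_null f tT)) subrr.
    move=> T; have := vP T; congr tends; apply/funext => n; exact/esym/v_fin.
  have v'v : v = v'.
    apply: bopP => T; apply: tends_uniq (vP T) _.
    have := v'V T; congr tends; apply/funext => n.
    by rewrite fE bopD (j'J _ (@tail_null_trunc _ _ _ p_gt1 _ n T)) add0r.
  by rewrite v'v fE addrK.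
- move=> j v jJ vV; by rewrite -!of_real_rnorm -of_realD rnorm_annihilator_trunc.
Qed.

End MIdealCompact.

(** * The equivalence for compact operators *)

Lemma tail_null_rank1 (R : realType) (s : scalars) (p : R) (p_gt1 : 1 < p)
    (Y : normedModType (scalar_field R s)) k (y : Y) :
  tail_null (rank1 (ltW p_gt1) k y).
Proof.
by move=> e e0; exists k.+1 => x _ xk; rewrite rank1E xk // scale0r rnorm0 ltW.
Qed.

Theorem corollary2p4 (R : realType) (s : scalars) (p : R) (p_gt1 : 1 < p)
    (Y : completeNormedModType (scalar_field R s)) :
  M_ideal (compact_operators (ell s (ltW p_gt1)) Y) <->
  (forall (y : Y) (T : bounded_op (ell s (ltW p_gt1)) Y),
    (limn_esup (fun n => (rnorm (y + T (unit_vector s (ltW p_gt1) n)))%:E)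
       <= ((rnorm y `^ p + rnorm T `^ p) `^ p^-1)%:E)%E).
Proof.
split=> [MJ y T|upper]; last first.
  by rewrite compact_operatorsE; exact: M_ideal_tail_null.
have sJ : submod_closed [in compact_operators (ell s (ltW p_gt1)) Y] by case: MJ.
have rank1C k z : compact_operators (ell s (ltW p_gt1)) Y (rank1 (ltW p_gt1) k z).
  by apply: tail_null_compact; exact: tail_null_rank1.
have two_ball := M_ideal_two_ball sJ MJ.
apply/limn_esup_le => e e0; rewrite -/(lp2 p _ _).
set L := lp2 p _ _; have L0 : 0 <= L by exact: lp2_ge0.
(* Replacing |y| and |T| by the positive |y| + d and |T| + d raises L by at most 2 d = e/2. The h
   below solves (1 + h) (L + e/2) + h = L + e. *)
pose d := e / 4; have d0 : 0 < d by rewrite divr_gt0.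
pose h := e / 2 / (L + e / 2 + 1).
have D0 : 0 < L + e / 2 + 1 by rewrite ltr_wpDl // addr_ge0 // divr_ge0 // ltW.
have h0 : 0 < h by rewrite divr_gt0 // divr_gt0.
have a0 : 0 < rnorm y + d by exact: ltr_wpDl (rnorm_ge0 y) d0.
have b0 : 0 < rnorm T + d by exact: ltr_wpDl (rnorm_ge0 T) d0.
have ya : rnorm y <= rnorm y + d by rewrite lerDl ltW.
have Tb : rnorm T <= rnorm T + d by rewrite lerDl ltW.
have [N NP] := two_ball_unit_bound two_ball rank1C a0 b0 ya Tb h0.
exists N => n /NP /le_trans; apply.
have ab : lp2 p (rnorm y + d) (rnorm T + d) <= L + (d + d).
  by apply: lp2_add (rnorm_ge0 y) (rnorm_ge0 T) (ltW d0) (ltW d0); exact: ltW.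
have h1 : 0 <= 1 + h by rewrite addr_ge0 // ltW.
apply: le_trans (lerD (ler_wpM2l h1 ab) (lexx h)) _.
rewrite le_eqVlt; apply/orP; left; apply/eqP.
have hD : h * (L + e / 2 + 1) = e / 2 by rewrite divfK // gt_eqF.
have -> : d + d = e / 2 by rewrite /d; field.
transitivity (L + e / 2 + h * (L + e / 2 + 1)); first by ring.
by rewrite hD; field.
Qed.
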